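(* Let $R$ be a local Cohen-Macaulay domain admitting a canonical module, and let $\omega_R\subseteq R$ be an ideal of $R$ that is a canonical module of $R$. Suppose that $\mathrm{Fitt}_{1}(\omega_R)=\omega_R$ and that the Cohen-Macaulay type of $R$ is at most $2$. Then $R$ is Gorenstein.
   Context: Local rings are Noetherian. For a finitely generated module $M$ over a Noetherian ring $R$, choose a finite free presentation $G\to F\to M\to 0$ with $\mathrm{rank}\,F=r$, and let $A$ be a matrix representing $G\to F$. The $j$th Fitting ideal of $M$ is $\mathrm{Fitt}_j(M)=I_{r-j}(A)$, where $I_t(A)$ is the ideal generated by the $t$-minors of $A$, with $I_t(A)=R$ for $t\le 0$. This is independent of the choices. Since a domain is generically Gorenstein, the canonical module of $R$ can be identified with an ideal of $R$. The Cohen-Macaulay type of $R$ equals the minimal number of generators $\mu(\omega_R)$ of its canonical module. *)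

(* Defs.v *)
From HB Require Import structures.
From mathcomp Require Import all_boot all_order all_algebra.
Set Implicit Arguments.
Unset Strict Implicit.
Unset Printing Implicit Defensive.
Import GRing.Theory.
Local Open Scope ring_scope.
Local Open Scope quotient_scope.

(* Ideals of R are terms of type [submodClosed R^o]; proper and prime ideals
   are terms of type [idealr R] and [prime_idealr R]. *)

Section Modules.
Variable R : comNzRingType.

Section CyclicModule.
Variable I : idealr R.
Implicit Types x y : {ideal_quot I}.

Definition quot_scale (a : R) x : {ideal_quot I} := \pi_({ideal_quot I}) a * x.

Fact quot_scaleA a b x : quot_scale a (quot_scale b x) = quot_scale (a * b) x.
Proof. by rewrite /quot_scale mulrA rmorphM. Qed.

Fact quot_scale1 : left_id 1 quot_scale.
Proof. by move=> x; rewrite /quot_scale rmorph1 mul1r. Qed.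

Fact quot_scaleDr : right_distributive quot_scale +%R.
Proof. by move=> a x y; rewrite /quot_scale mulrDr. Qed.

Fact quot_scaleDl x : {morph quot_scale^~ x : a b / a + b}.
Proof. by move=> a b; rewrite /quot_scale rmorphD mulrDl. Qed.

HB.instance Definition _ := GRing.Zmodule_isLmodule.Build R {ideal_quot I}
  quot_scaleA quot_scale1 quot_scaleDr quot_scaleDl.
End CyclicModule.

Section IdealModule.
Variable I : submodClosed R^o.

Definition ideal_mod := {x : R^o | x \in I}.

HB.instance Definition _ := SubChoice.on ideal_mod.
HB.instance Definition _ := [SubChoice_isSubLmodule of ideal_mod by <:].
End IdealModule.

Definition generated (V : lmodType R) (s : seq V) (v : V) : Prop :=
  exists c : 'I_(size s) -> R, v = \sum_(i < size s) c i *: s`_i.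

Definition finitely_generated (V : lmodType R) : Prop :=
  exists s : seq V, forall v, generated s v.

Definition noetherian : Prop :=
  forall I : submodClosed R^o, exists s : seq R^o,
    forall x, x \in I <-> generated s x.

Definition maximal_ideal (m : idealr R) : Prop :=
  forall J : idealr R, {subset m <= J} -> {subset J <= m}.

Definition local_ring (m : idealr R) : Prop :=
  [/\ noetherian, maximal_ideal m
    & forall m' : idealr R, maximal_ideal m' -> m' =i m].

(* Only the first [n.+1] terms of the sequence matter. *)
Definition prime_chain (n : nat) (p : nat -> prime_idealr R) : Prop :=
  forall i, (i < n)%N ->
    {subset p i <= p i.+1} /\ ~ {subset p i.+1 <= p i}.

Definition krull_dim (d : nat) : Prop :=
  (exists p, prime_chain d p) /\ forall n p, prime_chain n p -> (n <= d)%N.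

(* [v] belongs to the submodule (s)M *)
Definition in_ideal_smul (M : lmodType R) (s : seq R) (v : M) : Prop :=
  exists w : 'I_(size s) -> M, v = \sum_(i < size s) s`_i *: w i.

Definition regular_sequence (M : lmodType R) (s : seq R) : Prop :=
  (forall i, (i < size s)%N -> forall v : M,
     in_ideal_smul (take i s) (s`_i *: v) -> in_ideal_smul (take i s) v)
  /\ exists v : M, ~ in_ideal_smul s v.

Definition depth (m : idealr R) (M : lmodType R) (t : nat) : Prop :=
  (exists s, [/\ {subset s <= m}, regular_sequence M s & size s = t])
  /\ forall s, {subset s <= m} -> regular_sequence M s -> (size s <= t)%N.

Definition cohen_macaulay (m : idealr R) : Prop :=
  local_ring m /\ exists d, krull_dim d /\ depth m R^o d.

Definition maximal_cohen_macaulay (m : idealr R) (M : lmodType R) : Prop :=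
  finitely_generated M /\ exists d, krull_dim d /\ depth m M d.

Definition injective_module (E : lmodType R) : Prop :=
  forall (A B : lmodType R) (f : {linear A -> B}) (g : {linear A -> E}),
    injective f -> exists h : {linear B -> E}, forall a, h (f a) = g a.

(* M has a finite injective resolution
   0 -> M -> E 0 -> E 1 -> ... -> E n -> 0. *)
Definition finite_injdim (M : lmodType R) : Prop :=
  exists (n : nat) (E : nat -> lmodType R) (e : {linear M -> E 0})
         (d : forall i, {linear E i -> E i.+1}),
    [/\ forall i, injective_module (E i),
        injective e,
        forall x, d 0 x = 0 <-> exists v, x = e v,
        forall i x, d i.+1 x = 0 <-> exists y, x = d i y
      & forall i, (n < i)%N -> forall x : E i, x = 0].

Definition gorenstein (m : idealr R) : Prop :=
  local_ring m /\ finite_injdim R^o.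

(* Resolutions by finite free modules; the differentials act on row vectors
   by right multiplication. *)
Record free_resolution (N : lmodType R) := FreeResolution {
  rk : nat -> nat;
  aug : {linear 'rV[R]_(rk 0) -> N};
  diff : forall i, 'M[R]_(rk i.+1, rk i);
  aug_surj : forall x, exists v, x = aug v;
  aug_ker : forall v, aug v = 0 <-> exists u, v = u *m diff 0;
  diff_ker : forall i (v : 'rV[R]_(rk i.+1)),
    v *m diff i = 0 <-> exists u, v = u *m diff i.+1
}.

(* Hom(R^n, M) is identified with the functions 'I_n -> M (values on the
   standard basis); [hom_mx A] is precomposition with u |-> u *m A. *)
Definition hom_mx (M : lmodType R) p n (A : 'M[R]_(p, n)) (f : 'I_n -> M) :
  'I_p -> M := fun j => \sum_k A j k *: f k.

Section Ext.
Variables (N M : lmodType R) (F : free_resolution N).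

Definition cocycle i (f : 'I_(rk F i) -> M) : Prop :=
  forall j, hom_mx (diff F i) f j = 0.

Definition coboundary i : ('I_(rk F i) -> M) -> Prop :=
  match i return ('I_(rk F i) -> M) -> Prop with
  | 0 => fun f => forall j, f j = 0
  | i'.+1 => fun f => exists g : 'I_(rk F i') -> M,
               forall j, f j = hom_mx (diff F i') g j
  end.
End Ext.

(* With k = R/m, the k-vector space Ext^i(k, M) = cocycles / coboundaries has
   dimension r: the classes of the cocycles [z a] form a k-basis. *)
Definition ext_dim (m : idealr R) (i : nat) (M : lmodType R) (r : nat) : Prop :=
  exists (F : free_resolution {ideal_quot m})
         (z : 'I_r -> 'I_(rk F i) -> M),
    [/\ forall a, cocycle (z a),
        forall f : 'I_(rk F i) -> M, cocycle f ->
          exists c : 'I_r -> R,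
            coboundary (fun j => f j - \sum_a c a *: z a j)
      & forall c : 'I_r -> R,
          coboundary (fun j => \sum_a c a *: z a j) -> forall a, c a \in m].

Definition cm_type (m : idealr R) (M : lmodType R) (r : nat) : Prop :=
  exists t, depth m M t /\ ext_dim m t M r.

Definition canonical_module (m : idealr R) (C : lmodType R) : Prop :=
  [/\ maximal_cohen_macaulay m C, cm_type m C 1 & finite_injdim C].

Definition increasing_maps (t n : nat) : seq {ffun 'I_t -> 'I_n} :=
  [seq f : {ffun 'I_t -> 'I_n} <- enum {ffun 'I_t -> 'I_n} |
    [forall i : 'I_t, forall j : 'I_t, (i < j)%N ==> (f i < f j)%N]].

Definition minors (t n r : nat) (A : 'M[R]_(n, r)) : seq R^o :=
  [seq \det (mxsub f g A) | f : {ffun 'I_t -> 'I_n} <- increasing_maps t n,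
                            g : {ffun 'I_t -> 'I_r} <- increasing_maps t r].

(* R^n -> R^r -> M -> 0 is exact, the first map being u |-> u *m A. *)
Definition presentation (M : lmodType R) n r
    (A : 'M[R]_(n, r)) (e : {linear 'rV[R]_r -> M}) : Prop :=
  (forall x, exists v, x = e v)
  /\ forall v, e v = 0 <-> exists u, v = u *m A.

(* The ideal I_(r-j)(A) does not depend on the presentation. The truncated
   subtraction is harmless: the only 0-minor is 1, so that I_0(A) = R. *)
Definition Fitt (j : nat) (M : lmodType R) (x : R) : Prop :=
  exists (n r : nat) (A : 'M[R]_(n, r)) (e : {linear 'rV[R]_r -> M}),
    presentation A e /\ generated (minors (r - j) A) x.

End Modules.

Arguments krull_dim R d : clear implicits.
Arguments noetherian R : clear implicits.

(* Main.v *)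
Require Import Defs.
From HB Require Import structures.
From mathcomp Require Import all_boot all_order all_algebra.
From mathcomp Require Import boolp ring.
From Stdlib Require List.
Set Implicit Arguments.
Unset Strict Implicit.
Unset Printing Implicit Defensive.
Import GRing.Theory.
Local Open Scope ring_scope.

(** Let [k] be the residue field and [d] the dimension of [R]. Everything is
    reduced modulo a sequence [s] of length [d] that is regular on both [R] and
    the canonical ideal [w]. It exists because Ext from [k] vanishes below the
    depth, so that the successive quotients have no socle and prime avoidance
    yields a common regular element ([common_regseq]). Moving along [s] turns
    the Ext module of degree [d] of [k] and [M] into the socle of [M / (s)M]
    ([ext_span_regseq], [ext_span_socle]): the socle of [w / (s)w] is a line,
    and that of [R / (s)] is spanned by [r <= 2] elements. As the depth of [R]
    is its dimension, [R / (s)] has dimension zero ([regseq_zero_dim]).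

    A module over [R / (s)] whose socle is a line has only scalar endomorphisms
    ([scalar_endos_socle]). By Nakayama's lemma this lifts along [s] to [w], and
    it follows that [w / (s)w] is faithful over [R / (s)]
    ([regseq_scalar_faithful]). Every functional on [w / mw], followed by the
    inclusion of the socle, is an endomorphism of [w / (s)w] and hence an
    element of the socle of [R / (s)]; this bounds the number of generators of
    [w] by [r] ([generators_le]).

    If [w] is principal, it is isomorphic to [R], which therefore has finite
    injective dimension. Otherwise [w = (a, b)] with [a] and [b] in [m]. The
    entries of the matrix of relations generate the first Fitting ideal, which
    is [w]; so a relation [x a + y b = 0] has [x] and [y] in [w], and the
    fraction [y / a] maps [w] into itself. Endomorphisms of [w] being scalars,
    the fraction lies in [R] ([relation_scalar]). Thus every relation is a
    multiple of [(- b, a)], and [0 -> R -> R ^ 2 -> w -> 0] is exact. Modulo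
    [s] the first map remains injective ([koszul_exact]); but its entries are
    in [m], so that it kills the socle of [R / (s)], which is not zero. *)

(** * Linear identities *)

Section LinearTerms.
Variables (R : comNzRingType) (M : lmodType R).

Inductive lterm :=
  | LAtom of nat | LZero | LAdd of lterm & lterm | LOpp of lterm
  | LScale of R & lterm.

Fixpoint lterm_val (env : seq M) t : M :=
  match t with
  | LAtom i => env`_i
  | LZero => 0
  | LAdd t1 t2 => lterm_val env t1 + lterm_val env t2
  | LOpp t1 => - lterm_val env t1
  | LScale a t1 => a *: lterm_val env t1
  end.

Fixpoint lterm_coef t (i : nat) : R :=
  match t with
  | LAtom j => if Nat.eqb i j then 1 else 0
  | LZero => 0
  | LAdd t1 t2 => lterm_coef t1 i + lterm_coef t2 i
  | LOpp t1 => - lterm_coef t1 i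
  | LScale a t1 => a * lterm_coef t1 i
  end.

Fixpoint lterm_eq t1 t2 n : Prop :=
  if n is n'.+1 then lterm_coef t1 n' = lterm_coef t2 n' /\ lterm_eq t1 t2 n'
  else True.

Lemma lterm_valE env t :
  lterm_val env t = \sum_(i < size env) lterm_coef t i *: env`_i.
Proof.
elim: t => /= [j||t1 -> t2 ->|t1 ->|a t1 ->].
- have [ltj|gej] := ltnP j (size env).
    rewrite (bigD1 (Ordinal ltj)) //= PeanoNat.Nat.eqb_refl scale1r.
    rewrite big1 ?addr0 // => i /eqP ij.
    case: PeanoNat.Nat.eqb_spec => [e|_]; last by rewrite scale0r.
    by case: ij; apply: val_inj.
  rewrite nth_default // big1 // => i _.
  case: PeanoNat.Nat.eqb_spec => [e|_]; last by rewrite scale0r.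
  by have := ltn_ord i; rewrite e ltnNge gej.
- by rewrite big1 // => i _; rewrite scale0r.
- by rewrite -big_split; apply: eq_bigr => i _; rewrite scalerDl.
- by rewrite -sumrN; apply: eq_bigr => i _; rewrite scaleNr.
- by rewrite scaler_sumr; apply: eq_bigr => i _; rewrite scalerA.
Qed.

Lemma lterm_eqP env t1 t2 :
  lterm_eq t1 t2 (size env) -> lterm_val env t1 = lterm_val env t2.
Proof.
move=> eq_t; rewrite !lterm_valE; apply: eq_bigr => -[i lti] _ /=.
congr (_ *: _); elim: (size env) lti eq_t => [//|n IHn].
by rewrite ltnS leq_eqVlt => /orP[/eqP->|/IHn {}IHn] [// _ /IHn].
Qed.

End LinearTerms.

(** Atoms are compared up to conversion: the same term may occur with distinct
   but convertible instances. *)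
Ltac lterm_index x env :=
  match env with
  | ?y :: _ => let _ := match goal with _ => unify x y end in constr:(0%N)
  | _ :: ?env' => let i := lterm_index x env' in constr:(S i)
  end.

Ltac lterm_add x env :=
  match goal with
  | _ => let i := lterm_index x env in env
  | _ => constr:(x :: env)
  end.

Ltac lterm_atoms t env :=
  lazymatch t with
  | (?t1 + ?t2)%R => let env1 := lterm_atoms t1 env in lterm_atoms t2 env1
  | (- ?t1)%R => lterm_atoms t1 env
  | (_ *: ?t1)%R => lterm_atoms t1 env
  | 0%R => env
  | _ => lterm_add t env
  end.

Ltac lterm_reify R t env :=
  lazymatch t with
  | (?t1 + ?t2)%R => let u1 := lterm_reify R t1 env in
                     let u2 := lterm_reify R t2 env in constr:(LAdd u1 u2)
  | (- ?t1)%R => let u1 := lterm_reify R t1 env in constr:(LOpp u1)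
  | (?a *: ?t1)%R => let u1 := lterm_reify R t1 env in
                     constr:(@LScale R a u1)
  | 0%R => constr:(@LZero R)
  | _ => let i := lterm_index t env in constr:(@LAtom R i)
  end.

(** [module R] proves an equation between linear combinations in an
    [R]-module by comparing the coefficients of the atoms. *)
Ltac module R :=
  lazymatch goal with
  | |- @eq ?T ?t1 ?t2 =>
    let env0 := lterm_atoms t1 (@nil T) in
    let env := lterm_atoms t2 env0 in
    let u1 := lterm_reify R t1 env in
    let u2 := lterm_reify R t2 env in
    refine (@lterm_eqP R _ env u1 u2 _);
    cbn [lterm_eq lterm_coef Nat.eqb size];
    repeat split; ring
  end.

(** * Submodules *)

Section Submodules.
Variable R : comNzRingType.

(** Submodules are predicates with values in [Prop]; a quotient [M / N] is
    handled as [M] together with congruences modulo [N]. *)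
Record submod (M : lmodType R) := Submod {
  sm_car :> M -> Prop;
  sm0 : sm_car 0;
  smZD : forall a u v, sm_car u -> sm_car v -> sm_car (a *: u + v)
}.

Section Theory.
Variables (M : lmodType R) (N : submod M).

Lemma smZ a u : N u -> N (a *: u).
Proof. by move=> Nu; rewrite -[_ *: _]addr0; apply: smZD => //; apply: sm0. Qed.

Lemma smD u v : N u -> N v -> N (u + v).
Proof. by move=> Nu Nv; rewrite -[u]scale1r; apply: smZD. Qed.

Lemma smN u : N u -> N (- u).
Proof. by rewrite -scaleN1r; apply: smZ. Qed.

Lemma smB u v : N u -> N v -> N (u - v).
Proof. by move=> Nu /smN; apply: smD. Qed.

Lemma smDr u v : N u -> N (u + v) <-> N v.
Proof.
move=> Nu; split; last exact: smD.
by move=> Nuv; rewrite -[v](addKr u); apply/smD/Nuv/smN.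
Qed.

Lemma smDl u v : N u -> N (v + u) <-> N v.
Proof. by rewrite addrC; apply: smDr. Qed.

Lemma smBC u v : N (u - v) -> N (v - u).
Proof. by rewrite -[v - u]opprB; apply: smN. Qed.

Lemma sm_trans v u t : N (u - v) -> N (v - t) -> N (u - t).
Proof. by move=> uv vt; rewrite -[u](subrK v) -addrA; apply: smD. Qed.

Lemma sm_congr u v : N (u - v) -> N u <-> N v.
Proof. by move=> uv; rewrite -[X in N X <-> _](subrK v); apply: smDr. Qed.

Lemma sm_sum (I : finType) (F : I -> M) : (forall i, N (F i)) -> N (\sum_i F i).
Proof.
by move=> NF; apply: big_ind => // [|u v]; [apply: sm0 | apply: smD].
Qed.

End Theory.

Lemma smM (P : submod R^o) (a b : R) : P b -> P (a * b).
Proof. exact: smZ. Qed.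

Section Constructions.
Variable M : lmodType R.

Fact zero_closed a (u v : M) : u = 0 -> v = 0 -> a *: u + v = 0.
Proof. by move=> -> ->; rewrite scaler0 addr0. Qed.
Definition zero_sm := Submod (erefl (0 : M)) zero_closed.

Definition full_sm := @Submod M (fun=> True) I (fun _ _ _ _ _ => I).

Variable N : submod M.

(** The submodule [N + xM]. *)
Section AddImage.
Variable x : R.
Definition addimg_car (v : M) := exists n t, N n /\ v = n + x *: t.
Fact addimg0 : addimg_car 0.
Proof. by exists 0, 0; rewrite scaler0 addr0; split=> //; apply: sm0. Qed.
Fact addimgZD a u v : addimg_car u -> addimg_car v -> addimg_car (a *: u + v).
Proof.
move=> [n [t [Nn ->]]] [n' [t' [Nn' ->]]].
exists (a *: n + n'), (a *: t + t'); split; first exact: smZD.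
by rewrite !scalerDr !scalerA (mulrC x) addrACA.
Qed.
Definition addimg := Submod addimg0 addimgZD.
End AddImage.

(** The submodule [N + Rt]. *)
Section AddSpan.
Variable t : M.
Definition addspan_car (v : M) := exists n c, N n /\ v = n + c *: t.
Fact addspan0 : addspan_car 0.
Proof. by exists 0, 0; rewrite scale0r addr0; split=> //; apply: sm0. Qed.
Fact addspanZD a u v :
  addspan_car u -> addspan_car v -> addspan_car (a *: u + v).
Proof.
move=> [n [c [Nn ->]]] [n' [c' [Nn' ->]]].
exists (a *: n + n'), (a * c + c'); split; first exact: smZD.
by rewrite !scalerDr !scalerDl scalerA addrACA.
Qed.
Definition addspan := Submod addspan0 addspanZD.
End AddSpan.

Section Annihilator.
Variable v : M.
Fact ann0 : N (0 *: v). Proof. by rewrite scale0r; apply: sm0. Qed.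
Fact annZD a (b c : R^o) : N (b *: v) -> N (c *: v) -> N ((a *: b + c) *: v).
Proof. by move=> Nb Nc; rewrite scalerDl -scalerA; apply: smZD. Qed.
Definition ann := @Submod R^o (fun a => N (a *: v)) ann0 annZD.
End Annihilator.

Lemma addimg_sub x v : N v -> addimg x v.
Proof. by move=> Nv; exists v, 0; rewrite scaler0 addr0. Qed.

Lemma addimg_img x v : addimg x (x *: v).
Proof. by exists 0, v; rewrite add0r; split=> //; apply: sm0. Qed.

Lemma addspan_sub t v : N v -> addspan t v.
Proof. by move=> Nv; exists v, 0; rewrite scale0r addr0. Qed.

Lemma addspan_gen t : addspan t t.
Proof. by exists 0, 1; rewrite add0r scale1r; split=> //; apply: sm0. Qed.

End Constructions.

Section Linear.
Variables (M M' : lmodType R) (f : {linear M -> M'}).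

Section Preimage.
Variable N : submod M'.
Fact preim0 : N (f 0). Proof. by rewrite linear0; apply: sm0. Qed.
Fact preimZD a u v : N (f u) -> N (f v) -> N (f (a *: u + v)).
Proof. by rewrite linearP; apply: smZD. Qed.
Definition preim_sm := @Submod M (fun v => N (f v)) preim0 preimZD.
End Preimage.

Section Image.
Variable N : submod M.
Definition im_car v := exists2 u, N u & v = f u.
Fact im0 : im_car 0. Proof. by exists 0; rewrite ?linear0 //; apply: sm0. Qed.
Fact imZD a u v : im_car u -> im_car v -> im_car (a *: u + v).
Proof.
move=> [u' Nu ->] [v' Nv ->]; exists (a *: u' + v'); first exact: smZD.
by rewrite linearP.
Qed.
Definition im_sm := Submod im0 imZD.
End Image.
End Linear.

(** * Noetherian modules *)

(** The maximum condition; it is the form in which finiteness is used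
    throughout, and it passes to extensions without any choice of
    generators. *)
Definition noeth (M : lmodType R) := forall P : submod M -> Prop,
  (exists U, P U) ->
  exists U, P U /\ forall U' : submod M, P U' ->
    (forall v, U v -> U' v) -> forall v, U' v -> U v.

Fixpoint gen_sm (M : lmodType R) (N : submod M) (s : seq M) : submod M :=
  if s is t :: s' then addspan (gen_sm N s') t else N.

Lemma gen_sm_in (M : lmodType R) (N U : submod M) s :
    (forall v, N v -> U v) -> (forall v, v \in s -> U v) ->
  forall v, gen_sm N s v -> U v.
Proof.
move=> NU; elim: s => [//|t s IHs] sU v /= [n [c [Nn ->]]].
apply: smD; first by apply: IHs Nn => u us; apply: sU; rewrite inE us orbT.
by apply/smZ/sU/mem_head.
Qed.

Lemma gen_sm_mem (M : lmodType R) (N : submod M) s v : v \in s -> gen_sm N s v.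
Proof.
elim: s => [//|t s IHs] /=; rewrite inE => /orP[/eqP->|/IHs].
  exact: addspan_gen.
exact: addspan_sub.
Qed.

Lemma gen_smP (M : lmodType R) (s : seq M) v :
  gen_sm (zero_sm M) s v <-> generated s v.
Proof.
elim: s v => [|t s IHs] v /=.
  split=> [->|[c ->]]; last by rewrite big_ord0.
  by exists (fun=> 0); rewrite big_ord0.
split=> [[n [c [/IHs [d ->] ->]]]|[c ->]].
  exists (fun i => oapp d c (unlift ord0 i)).
  rewrite big_ord_recl unlift_none /= addrC; congr (_ + _).
  by apply: eq_bigr => i _; rewrite liftK.
rewrite big_ord_recl /= addrC.
exists (\sum_(i < size s) c (lift ord0 i) *: s`_i), (c ord0).
by split=> //; apply/IHs; exists (fun i => c (lift ord0 i)).
Qed.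

Section PropToBool.
Variables (M : lmodType R) (N : submod M).
Definition sm_pred : {pred M} := fun v => `[< N v >].
Fact sm_pred_closed : submod_closed sm_pred.
Proof.
split=> [|a u v]; first by apply/asboolP; apply: sm0.
by rewrite !unfold_in => /asboolP Nu /asboolP Nv; apply/asboolP; apply: smZD.
Qed.
HB.instance Definition _ :=
  GRing.isSubmodClosed.Build R M sm_pred sm_pred_closed.
Definition bool_sm : submodClosed M := sm_pred.
Lemma bool_smP v : v \in bool_sm <-> N v.
Proof. by rewrite unfold_in; split=> /asboolP. Qed.
End PropToBool.

(** A strictly increasing sequence of submodules contradicts the finite
    generation of its union. *)
Lemma fg_noeth (M : lmodType R) :
  (forall N : submod M, exists s, forall v, N v <-> generated s v) -> noeth M.
Proof.
move=> fgM P [U0 PU0]; apply: contrapT => /forallNP noMax.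
have step (U : {U : submod M | P U}) : exists U' : {U : submod M | P U},
    (forall v, sval U v -> sval U' v) /\ exists v, sval U' v /\ ~ sval U v.
  case: U => U PU /=; apply: contrapT => noU; apply: (noMax U).
  split=> // U' PU' UU' v U'v; apply: contrapT => nUv; apply: noU.
  exists (exist _ U' PU').
  by split=> //; exists v.
have [next nextP] := choice step.
pose chain n := iter n next (exist _ U0 PU0).
have chain_le i j v : (i <= j)%N -> sval (chain i) v -> sval (chain j) v.
  move=> /subnK <-; elim: (j - i)%N => [//|k IHk] Uv.
  by rewrite addSn /=; apply: (nextP _).1; apply: IHk.
pose C v := exists n, sval (chain n) v.
have C0 : C 0 by exists 0; apply: sm0.
have CZD a u v : C u -> C v -> C (a *: u + v).
  move=> [i Ui] [j Uj]; exists (maxn i j).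
  by apply: smZD; [apply: chain_le Ui; apply: leq_maxl
                  | apply: chain_le Uj; apply: leq_maxr].
have [s sP] := fgM (Submod C0 CZD).
have [n nP] : exists n, forall v, v \in s -> sval (chain n) v.
  have : forall v, v \in s -> C v.
    by move=> v vs; apply/sP/gen_smP/gen_sm_mem.
  elim: s {sP} => [|t s IHs] sC; first by exists 0.
  have [|n nP] := IHs; first by move=> v vs; apply: sC; rewrite inE vs orbT.
  have [k kP] := sC t (mem_head t s).
  exists (maxn n k) => v; rewrite inE => /orP[/eqP->|/nP].
    by apply: chain_le kP; apply: leq_maxr.
  by apply: chain_le; apply: leq_maxl.
have [_ [v [Uv nUv]]] := nextP (chain n); apply: nUv.
have /sP/gen_smP : C v by exists n.+1.
by apply: gen_sm_in => // u ->; apply: sm0.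
Qed.

Lemma noetherian_noeth : noetherian R -> noeth R^o.
Proof.
move=> nR; apply: fg_noeth => N; have [s sP] := nR (bool_sm N).
by exists s => v; rewrite -sP bool_smP.
Qed.

Lemma noeth_fg (M : lmodType R) (U : submod M) :
  noeth M -> exists s, forall v, U v <-> generated s v.
Proof.
move=> nM; pose P N := exists2 s, (forall v, v \in s -> U v)
                                  & N = gen_sm (zero_sm M) s.
have [|N [[s sU ->] sMax]] := nM P; first by exists (zero_sm M), [::].
have sinU := @gen_sm_in M (zero_sm M) U s _ sU.
exists s => v; rewrite -gen_smP; split=> [Uv|]; last first.
  by apply: sinU => u ->; apply: sm0.
apply: (sMax (gen_sm (zero_sm M) (v :: s))); last exact: addspan_gen.
  by exists (v :: s) => // u; rewrite inE => /orP[/eqP->|/sU].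
by move=> u; apply: addspan_sub.
Qed.

(** Among the submodules of a family take those whose trace on the kernel is
    maximal, and among these one whose image is maximal. *)
Lemma noeth_ext (A B M : lmodType R) (g : {linear A -> M})
    (f : {linear M -> B}) :
  noeth A -> noeth B -> (forall v, f v = 0 -> exists u, v = g u) -> noeth M.
Proof.
move=> nA nB exact_fg P [U0 PU0].
have [|K [[U1 PU1 KU1] maxK]] :=
    nA (fun K => exists2 U, P U & K = preim_sm g U).
  by exists (preim_sm g U0), U0.
have [|C [[U [PU [KU CU]]] maxC]] := nB (fun C => exists U,
    P U /\ ((forall u, K u -> U (g u)) /\ C = im_sm f U)).
  by exists (im_sm f U1), U1; split=> //; split=> // u; rewrite KU1.
exists U; split=> // U' PU' UU' v U'v.
have : C (f v).
  apply: (maxC (im_sm f U')); last by exists v.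
    by exists U'; split=> //; split=> // u /KU /UU'.
  by move=> x; rewrite CU => -[u Uu ->]; exists u => //; apply: UU'.
rewrite CU => -[w Uw fvw].
have /exact_fg [u vw] : f (v - w) = 0 by rewrite linearB fvw subrr.
rewrite -[v](subrK w) vw; apply: smD => //; apply: (KU).
apply: (maxK (preim_sm g U')); first by exists U'.
  by move=> t /KU /UU'.
by rewrite /= -vw; apply: smB => //; apply: UU'.
Qed.

Lemma noeth_inj (M M' : lmodType R) (f : {linear M -> M'}) :
  injective f -> noeth M' -> noeth M.
Proof.
move=> f_inj nM' P [U0 PU0].
have [|C [[U PU ->] maxC]] := nM' (fun C => exists2 U, P U & C = im_sm f U).
  by exists (im_sm f U0), U0.
exists U; split=> // U' PU' UU' v U'v.
suff [w Uw /f_inj ->] : im_sm f U (f v) by [].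
apply: (maxC (im_sm f U')); first by exists U'.
  by move=> _ [u Uu ->]; exists u => //; apply: UU'.
by exists v.
Qed.

Section NoethPower.
Variable M : lmodType R.

Definition ffun_head n (f : {ffun 'I_n.+1 -> M}) : M := f ord0.
Fact ffun_head_linear n : linear (@ffun_head n).
Proof. by move=> a f g; rewrite /ffun_head !ffunE. Qed.
HB.instance Definition _ n := GRing.isLinear.Build R {ffun 'I_n.+1 -> M} M
  *:%R (@ffun_head n) (@ffun_head_linear n).

Definition ffun_behead0 n (f : {ffun 'I_n -> M}) : {ffun 'I_n.+1 -> M} :=
  [ffun i => oapp f 0 (unlift ord0 i)].
Fact ffun_behead0_linear n : linear (@ffun_behead0 n).
Proof.
move=> a f g; apply/ffunP=> i; rewrite !ffunE.
by case: unliftP => [j _|_] /=; rewrite ?ffunE // scaler0 addr0.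
Qed.
HB.instance Definition _ n := GRing.isLinear.Build R {ffun 'I_n -> M}
  {ffun 'I_n.+1 -> M} *:%R (@ffun_behead0 n) (@ffun_behead0_linear n).

Lemma noeth_ffun n : noeth M -> noeth {ffun 'I_n -> M}.
Proof.
move=> nM; elim: n => [|n IHn].
  move=> P [U PU]; exists U; split=> // U' _ _ v _.
  by rewrite (_ : v = 0); [apply: sm0 | apply/ffunP=> -[]].
apply: (@noeth_ext _ _ _ (@ffun_behead0 n) (@ffun_head n) IHn nM) => f f0.
exists [ffun i => f (lift ord0 i)]; apply/ffunP=> i; rewrite !ffunE.
by case: unliftP => [j ->|-> //]; rewrite /= ffunE.
Qed.

End NoethPower.

Definition ffun_of_row n (v : 'rV[R]_n) : {ffun 'I_n -> R^o} :=
  [ffun i => v 0 i].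
Fact ffun_of_row_linear n : linear (@ffun_of_row n).
Proof. by move=> a u v; apply/ffunP=> i; rewrite !ffunE !mxE. Qed.
HB.instance Definition _ n := GRing.isLinear.Build R 'rV[R]_n
  {ffun 'I_n -> R^o} *:%R (@ffun_of_row n) (@ffun_of_row_linear n).

Lemma noeth_row n : noeth R^o -> noeth 'rV[R]_n.
Proof.
move=> nR; apply: (@noeth_inj _ _ (@ffun_of_row n)); last exact: noeth_ffun.
by move=> u v /ffunP uv; apply/rowP=> i; have := uv i; rewrite !ffunE.
Qed.

End Submodules.

(** * Local rings *)

Section ProperIdeal.
Variables (R : comNzRingType) (N : submod R^o) (N1 : ~ N 1).
Definition ideal_pred (_ : ~ N 1) : R -> bool := fun a => `[< N a >].
Fact ideal_pred_closed : idealr_closed (ideal_pred N1 : {pred R}).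
Proof.
split; first by apply/asboolP; apply: sm0.
  exact/asboolPn.
by move=> a u v /asboolP Nu /asboolP Nv; apply/asboolP/(smZD a Nu Nv).
Qed.
HB.instance Definition _ := isIdealr.Build R (ideal_pred N1) ideal_pred_closed.
Definition ideal_of : idealr R := ideal_pred N1.
Lemma ideal_ofP a : a \in ideal_of <-> N a.
Proof. by rewrite unfold_in; split=> /asboolP. Qed.
End ProperIdeal.

Section Local.
Variables (R : comNzRingType) (m : idealr R).

Section IdealSubmod.
Variable J : idealr R.
Fact ideal_sm_closed a (b c : R^o) : b \in J -> c \in J -> a *: b + c \in J.
Proof. by move=> bm cm; rewrite rpredD // idealMr. Qed.
Definition ideal_sm := @Submod R R^o (fun a : R^o => a \in J) (idealr0 J)
  ideal_sm_closed.
Lemma ideal_sm1 : ~ ideal_sm 1. Proof. by rewrite /= idealr1. Qed.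
End IdealSubmod.

Hypothesis mP : local_ring m.

Lemma local_noeth : noeth R^o.
Proof. by case: mP => nR _ _; apply: noetherian_noeth. Qed.

Lemma proper_sub_maximal (N : submod R^o) a : ~ N 1 -> N a -> a \in m.
Proof.
move=> N1 Na; have [_ _ m_max] := mP.
have [|U [[U1 NU] maxU]] :=
    local_noeth (P := fun U => ~ U 1 /\ forall b, N b -> U b).
  by exists N.
rewrite -(m_max (ideal_of U1)); first exact/ideal_ofP/NU.
move=> J UJ b bJ; apply/ideal_ofP; apply: (maxU (ideal_sm J)) => //.
  by split=> [|c /NU Uc]; [apply: ideal_sm1 | apply/UJ/ideal_ofP].
by move=> c Uc; apply/UJ/ideal_ofP.
Qed.

Lemma local_unit a : a \notin m -> exists b, b * a = 1.
Proof.
move=> /negP am; apply: contrapT => nb; apply: am.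
apply: (@proper_sub_maximal (addspan (zero_sm _) (a : R^o))).
  by move=> [_ [b [-> e]]]; apply: nb; exists b; rewrite e add0r.
exact: addspan_gen.
Qed.

Lemma maximal_prime a b : a * b \in m -> a \in m \/ b \in m.
Proof.
move=> abm; case: (boolP (a \in m)) => [|/local_unit [c ca]]; first by left.
by right; rewrite -[b]mul1r -ca -mulrA idealMr.
Qed.

Lemma local_sub1_unit a : a \in m -> exists b, b * (1 - a) = 1.
Proof.
move=> am; apply: local_unit; apply/negP => am1.
by have := idealr1 m; rewrite -[1](subrK a) rpredD.
Qed.

(** Nakayama's lemma: a proper submodule lies in a maximal one, and a maximal
    submodule contains [mM]. *)
Lemma maximal_submod (M : lmodType R) (N : submod M) v :
    noeth M -> ~ N v -> exists L : submod M,
  [/\ forall u, N u -> L u, exists u, ~ L u,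
      forall u, ~ L u -> forall t, addspan L u t
    & forall a u, a \in m -> L (a *: u)].
Proof.
move=> nM Nv.
have [|L [[NL [u0 Lu0]] maxL]] :=
    nM (fun L => (forall u, N u -> L u) /\ exists u, ~ L u).
  by exists N; split=> //; exists v.
have Lmax u : ~ L u -> forall t, addspan L u t.
  move=> Lu t; apply: contrapT => nt; apply: Lu.
  apply: (maxL (addspan L u)); last exact: addspan_gen.
    by split; [move=> w /NL; apply: addspan_sub | exists t].
  by move=> w; apply: addspan_sub.
exists L; split=> //; first by exists u0.
move=> a u am; apply: contrapT => Lau.
have [l [c [Ll ul]]] := Lmax _ Lau u.
have [b b1] := local_sub1_unit (idealMr c am).
apply: Lau; apply: smZ; rewrite -[u]scale1r -b1 -scalerA; apply: smZ.
by rewrite scalerBl scale1r {1}ul -scalerA addrK.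
Qed.

End Local.

(** * Associated primes and regular elements *)

Section Associated.
Variables (R : comNzRingType) (m : idealr R).

Definition prime_sm (P : submod R^o) :=
  ~ P 1 /\ forall a b : R, P (a * b) -> P a \/ P b.

Definition regular (M : lmodType R) (N : submod M) (x : R) :=
  forall v, N (x *: v) -> N v.

Definition socle (M : lmodType R) (N : submod M) (v : M) :=
  forall a, a \in m -> N (a *: v).

Section Family.
Variables (M : lmodType R) (N : submod M).

Definition maximal_ann u := ~ N u /\ forall u', ~ N u' ->
  (forall a, ann N u a -> ann N u' a) -> forall a, ann N u' a -> ann N u a.

Lemma maximal_ann_ex v : noeth R^o -> ~ N v ->
  exists u, maximal_ann u /\ forall a, ann N v a -> ann N u a.
Proof.
move=> nR Nv; have [|P [[u [Nu vu ->]] maxP]] := nR (fun P => exists u,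
    [/\ ~ N u, forall a, ann N v a -> ann N u a & P = ann N u]).
  by exists (ann N v), v.
exists u; split=> //; split=> // u' Nu' uu'.
by apply: (maxP (ann N u')) => //; exists u'; split=> // a /vu /uu'.
Qed.

Lemma maximal_ann_prime u : maximal_ann u -> prime_sm (ann N u).
Proof.
move=> [Nu maxu]; split=> [|a b abu]; first by rewrite /= scale1r.
have [Nau|Nau] := pselect (N (a *: u)); first by left.
right; apply: (maxu (a *: u)) => // [c|]; rewrite /= scalerA.
  by move=> Ncu; rewrite mulrC -scalerA; apply: smZ.
by rewrite mulrC.
Qed.

(** A module generated by elements with maximal annihilators is generated by
    finitely many of them; a prime containing an intersection of annihilators
    contains one of them, so that by maximality no other annihilator occurs. *)
Lemma maximal_ann_finite : noeth M -> exists us : seq M,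
  (forall u, u \in us -> maximal_ann u) /\
  forall u, maximal_ann u -> exists2 u', u' \in us &
    forall a, ann N u a -> ann N u' a.
Proof.
move=> nM.
have [|L [[us maxus ->] maxL]] := nM (fun L => exists2 us : seq M,
    (forall u, u \in us -> maximal_ann u) & L = gen_sm N us).
  by exists N, [::].
exists us; split=> // u maxu.
suff [u' us' u'u] : exists2 u', u' \in us & forall a, ann N u' a -> ann N u a.
  by exists u' => //; apply: (maxus u' us').2 => //; case: maxu.
apply: contrapT => no_u'.
have [prime1 primeM] := maximal_ann_prime maxu.
have [a a_us au] :
    exists2 a : R, forall u', u' \in us -> ann N u' a & ~ ann N u a.
  elim: (us) no_u' => [|t s IHs] no_u'; first by exists 1.
  have [|a a_s au] := IHs.
    move=> [u' u's u'u]; apply: no_u'; exists u' => //.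
    by rewrite inE u's orbT.
  have [b bt bu] : exists2 b, ann N t b & ~ ann N u b.
    apply: contrapT => nb; apply: no_u'; exists t; first exact: mem_head.
    by move=> b bt; apply: contrapT => bu; apply: nb; exists b.
  exists (a * b); last by move/primeM => [].
  move=> u'; rewrite inE => /orP[/eqP->|/a_s Nau'] /=.
    by rewrite -scalerA; apply: smZ.
  by rewrite mulrC -scalerA; apply: smZ.
apply: au; have : gen_sm N us u.
  apply: (maxL (gen_sm N (u :: us))); last exact: addspan_gen.
    by exists (u :: us) => // t; rewrite inE => /orP[/eqP->|/maxus].
  by move=> t; apply: addspan_sub.
move=> /(@gen_sm_in _ _ N (preim_sm (GRing.scale a) N)); apply=> // t.
exact: smZ.
Qed.

End Family.

(** Prime avoidance. If [x] avoids the primes of [s] but lies in [P], correct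
    it by an element outside [P] of all primes of [s] not contained in [P]. *)
Lemma prime_avoidance (s : list (submod R^o)) :
    (forall P, List.In P s -> prime_sm P /\ exists2 a, a \in m & ~ P a) ->
  exists2 x, x \in m & forall P, List.In P s -> ~ P x.
Proof.
elim: s => [|P s IHs] sP; first by exists 0; rewrite ?idealr0.
have [|x xm xs] := IHs; first by move=> Q Qs; apply: sP; right.
have [[P1 PM] [a am Pa]] := sP P (or_introl erefl).
have [Px|Px] := pselect (P x); last first.
  by exists x => // Q [<-|/xs].
have [z [zm Pz zs]] : exists z, [/\ z \in m, ~ P z &
    forall Q, List.In Q s -> (exists2 b, Q b & ~ P b) -> Q z].
  elim: s {IHs sP xs} => [|Q s [z [zm Pz zs]]]; first by exists a.
  have [[b Qb Pb]|QP] := pselect (exists2 b, Q b & ~ P b); last first.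
    by exists z; split=> // Q' [<-|/zs].
  exists (b * z); split; first by rewrite idealMr.
    by move/PM => [].
  move=> Q' [<- _|Q's nQ'P]; first by rewrite mulrC; apply: smM.
  by apply/smM/zs.
exists (x + z); first by rewrite rpredD.
have Pxz : ~ P (x + z) by move/(smDr _ Px).
move=> Q [<- //|Qs] Qxz.
have [QP|QP] := pselect (exists2 b, Q b & ~ P b).
  by have [/(_ Qxz) Qx _] := @smDl _ R^o Q z x (zs _ Qs QP); apply: (xs _ Qs).
by apply: QP; exists (x + z).
Qed.

Lemma List_inP (T : eqType) (x : T) s : List.In x s <-> x \in s.
Proof.
elim: s => //= y s IHs; rewrite inE; split=> [[->|/IHs ->]|].
- by rewrite eqxx.
- by rewrite orbT.
- by move=> /orP[/eqP->|/IHs]; [left|right].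
Qed.

Lemma zero_divisor_primes (M : lmodType R) (N : submod M) :
    noeth R^o -> noeth M -> (forall v, socle N v -> N v) ->
  exists s : list (submod R^o),
    (forall P, List.In P s -> prime_sm P /\ exists2 a, a \in m & ~ P a) /\
    forall x, (forall P, List.In P s -> ~ P x) -> regular N x.
Proof.
move=> nR nM soc0; have [us [usmax usP]] := maximal_ann_finite N nM.
exists (List.map (ann N) us); split=> [P|x xs v Nxv].
  move=> /List.in_map_iff [u [<- /List_inP /usmax maxu]].
  split; first exact: maximal_ann_prime.
  apply: contrapT => nam; case: (maxu) => Nu _; apply: Nu.
  apply: soc0 => a am; apply: contrapT => Nau.
  by apply: nam; exists a.
apply: contrapT => Nv; have [u [maxu vu]] := maximal_ann_ex nR Nv.
have [u' u'us uu'] := usP u maxu.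
apply: (xs (ann N u')); last by apply/uu'/vu.
by apply: List.in_map; apply/List_inP.
Qed.

Lemma common_regular (M M' : lmodType R) (N : submod M) (N' : submod M') :
    noeth R^o -> noeth M -> noeth M' -> (forall v, socle N v -> N v) ->
    (forall v, socle N' v -> N' v) ->
  exists x, [/\ x \in m, regular N x & regular N' x].
Proof.
move=> nR nM nM' soc0 soc0'.
have [s [sP sreg]] := zero_divisor_primes nR nM soc0.
have [s' [sP' sreg']] := zero_divisor_primes nR nM' soc0'.
have [|x xm xs] := @prime_avoidance (s ++ s').
  by move=> P /List.in_app_iff [/sP|/sP'].
by exists x; split=> //; [apply: sreg|apply: sreg'] => P Ps; apply: xs;
  apply/List.in_app_iff; [left|right].
Qed.

End Associated.

(** * Regular sequences *)

Section RegularSequences.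
Variable R : comNzRingType.

(** The submodule [(s)M]; the head of [s] is the last element of the sequence,
    so that a regular sequence is extended by [cons]. *)
Fixpoint seq_sm (M : lmodType R) (s : seq R) : submod M :=
  if s is x :: s' then addimg (seq_sm M s') x else zero_sm M.

Fixpoint regseq (M : lmodType R) (s : seq R) : Prop :=
  if s is x :: s' then regular (seq_sm M s') x /\ regseq M s' else True.

Lemma in_ideal_smul_rcons (M : lmodType R) s x (v : M) :
  in_ideal_smul (rcons s x) v <->
  exists u t, in_ideal_smul s u /\ v = u + x *: t.
Proof.
rewrite /in_ideal_smul size_rcons; split=> [[w ->]|[u [t [[w ->] ->]]]].
  exists (\sum_(i < size s) s`_i *: w (widen_ord (leqnSn _) i)), (w ord_max).
  split; first by exists (fun i => w (widen_ord (leqnSn _) i)).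
  rewrite big_ord_recr /= nth_rcons ltnn eqxx; congr (_ + _).
  by apply: eq_bigr => i _; rewrite nth_rcons ltn_ord.
exists (fun i => oapp w t (unlift ord_max i)); rewrite big_ord_recr /=.
rewrite unlift_none nth_rcons ltnn eqxx; congr (_ + _).
apply: eq_bigr => i _; rewrite nth_rcons ltn_ord.
have -> : widen_ord (leqnSn (size s)) i = lift ord_max i.
  by apply: val_inj; rewrite /= /bump leqNgt ltn_ord.
by rewrite liftK.
Qed.

Lemma in_ideal_smul_rev (M : lmodType R) s (v : M) :
  in_ideal_smul s v <-> seq_sm M (rev s) v.
Proof.
elim/last_ind: s v => [|s x IHs] v.
  split=> [[w ->]|->]; first by rewrite big_ord0.
  by exists (fun=> 0); rewrite big_ord0.
rewrite rev_rcons in_ideal_smul_rcons.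
by split=> -[u [t [/IHs us ->]]]; exists u, t.
Qed.

Lemma regular_sequence_regseq (M : lmodType R) s :
  regular_sequence M s -> regseq M (rev s) /\ exists v, ~ seq_sm M (rev s) v.
Proof.
move=> [s_reg [v vs]]; split; last by exists v => /in_ideal_smul_rev.
elim/last_ind: s s_reg {v vs} => [//|s x IHs] s_reg; rewrite rev_rcons; split.
  move=> v /in_ideal_smul_rev sxv; apply/in_ideal_smul_rev.
  have := s_reg (size s); rewrite size_rcons ltnSn => /(_ isT v).
  by rewrite nth_rcons ltnn eqxx -cats1 take_size_cat //; apply.
apply: IHs => i i_s v; have := s_reg i; rewrite size_rcons ltnS ltnW //.
move=> /(_ isT v).
by rewrite nth_rcons i_s -cats1 takel_cat // ltnW.
Qed.

Lemma seq_sm_ideal (M : lmodType R) s (a : R) (v : M) :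
  seq_sm R^o s a -> seq_sm M s (a *: v).
Proof.
elim: s a => [|x s IHs] a /=; first by move=> ->; rewrite scale0r.
move=> [b [c [sb ->]]]; exists (b *: v), (c *: v); split; first exact: IHs.
by rewrite scalerDl scalerA.
Qed.

Lemma seq_sm_sub (M : lmodType R) (m : idealr R) (L : submod M) s :
    {subset s <= m} -> (forall a v, a \in m -> L (a *: v)) ->
  forall v, seq_sm M s v -> L v.
Proof.
move=> + mL; elim: s => [|x s IHs] sm v /=; first by move=> ->; apply: sm0.
move=> [u [t [su ->]]]; apply: smD; last exact/mL/sm/mem_head.
by apply: IHs su => y ys; apply: sm; rewrite inE ys orbT.
Qed.

End RegularSequences.

(** * Dimension *)

Section PrimeIdeal.
Variables (R : comNzRingType) (P : submod R^o) (PP : prime_sm P).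
Definition prime_pred (_ : prime_sm P) : R -> bool := fun a => `[< P a >].
Fact prime_pred_ideal : idealr_closed (prime_pred PP : {pred R}).
Proof. exact: ideal_pred_closed (proj1 PP). Qed.
HB.instance Definition _ := isIdealr.Build R (prime_pred PP) prime_pred_ideal.
Fact prime_pred_prime : prime_idealr_closed (prime_pred PP : {pred R}).
Proof.
move=> a b /asboolP abP; apply/orP.
by have [Pa|Pb] := proj2 PP a b abP; [left|right]; apply/asboolP.
Qed.
HB.instance Definition _ :=
  isPrimeIdealrClosed.Build R (prime_pred PP) prime_pred_prime.
Definition prime_of : prime_idealr R := prime_pred PP.
Lemma prime_ofP a : a \in prime_of <-> P a.
Proof. by rewrite unfold_in; split=> /asboolP. Qed.
End PrimeIdeal.

Section Dimension.
Variable R : comNzRingType.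

Lemma prime_chain_extend n (c : nat -> prime_idealr R) (p : prime_idealr R) :
    prime_chain n c -> {subset c n <= p} -> ~ {subset p <= c n} ->
  exists c', prime_chain n.+1 c' /\ c' n.+1 = p.
Proof.
move=> cn cp pc; exists (fun i => if (i <= n)%N then c i else p).
split=> [i|]; last by rewrite ltnn.
rewrite ltnS => le_in; have [->|ne_in] := eqVneq i n.
  by rewrite leqnn ltnn.
by rewrite le_in ltn_neqAle ne_in le_in; apply: cn; rewrite ltn_neqAle ne_in.
Qed.

(** An ideal maximal among those that contain [I] and avoid all products
    [x ^+ n * b] with [b] outside [P] is a prime inside [P] without [x]. *)
Lemma prime_below (I P : submod R^o) (x : R) :
    noeth R^o -> regular I x -> prime_sm P -> (forall a, I a -> P a) ->
  exists Q, [/\ prime_sm Q, forall a, I a -> Q a, forall a, Q a -> P a & ~ Q x].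
Proof.
move=> nR reg_x [P1 PM] IP.
pose T (c : R) := exists n b, ~ P b /\ c = x ^+ n * b.
have T_P b : ~ P b -> T b by exists 0, b; rewrite mul1r.
have TM a b : T a -> T b -> T (a * b).
  move=> [i [a' [Pa' ->]]] [j [b' [Pb' ->]]].
  by exists (i + j)%N, (a' * b'); rewrite exprD mulrACA; split=> // /PM [].
have [|Q [[IQ QT] maxQ]] := nR (fun Q =>
    (forall a, I a -> Q a) /\ forall a, T a -> ~ Q a).
  exists I; split=> // _ [n [b [Pb ->]]] Ixb; apply: Pb; apply: IP.
  elim: n Ixb => [|n IHn]; rewrite ?mul1r // exprS -mulrA => /reg_x; exact: IHn.
exists Q; split=> //; last first.
- by apply: QT; exists 1%N, 1; rewrite mulr1.
- by move=> a Qa; apply: contrapT => /T_P /QT.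
split=> [|a b Qab]; first exact/QT/T_P.
have meets c : ~ Q c -> exists2 t : R, T t & addspan Q c t.
  move=> Qc; apply: contrapT => nt; apply: Qc.
  apply: (maxQ (addspan Q c)); last exact: addspan_gen.
    split=> [e /IQ|e Te ec]; first exact: addspan_sub.
    by apply: nt; exists e.
  by move=> e; apply: addspan_sub.
have [Qa|/meets [t Tt [q [c [Qq tq]]]]] := pselect (Q a); first by left.
right; apply: contrapT => /meets [t' Tt' [q' [c' [Qq' tq']]]].
apply: (QT (t * t')); first exact: TM.
rewrite tq tq' mulrDr; apply: smD; first exact: smM.
rewrite mulrC mulrDr; apply: smD; first exact: smM.
have -> : c' *: (b : R^o) * (c *: (a : R^o)) = (c * c') * (a * b) :> R.
  rewrite /GRing.scale /= [LHS]mulrACA mulrC [a * b]mulrC.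
  by rewrite [c * c']mulrC mulrC.
exact: smM.
Qed.

(** The chain is built downwards from [P], removing one element of [s] at each
    step. *)
Lemma regseq_chain s (P : submod R^o) (PP : prime_sm P) :
    noeth R^o -> regseq R^o s -> (forall a, seq_sm R^o s a -> P a) ->
  exists c, prime_chain (size s) c /\ c (size s) = prime_of PP.
Proof.
move=> nR; elim: s P PP => [|x s IHs] P PP /=.
  by move=> _ _; exists (fun=> prime_of PP).
move=> [reg_x reg_s] sP.
have [|Q [QP sQ subQP Qx]] := prime_below nR reg_x PP.
  by move=> a sa; apply/sP/addimg_sub.
have [c [chain_c cQ]] := IHs Q QP reg_s sQ.
apply: prime_chain_extend chain_c _ _; rewrite cQ.
  by move=> a /prime_ofP /subQP /prime_ofP.
move=> /(_ x) QPx; apply: Qx; apply/(prime_ofP QP)/QPx/prime_ofP/sP.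
have := @addimg_img _ R^o (seq_sm R^o s) x 1.
by rewrite (_ : x *: (1 : R^o) = x) //; apply: mulr1.
Qed.

Variable m : idealr R.
Hypothesis mP : local_ring m.

Definition zero_dim (s : seq R) := forall P : submod R^o,
  prime_sm P -> (forall a, seq_sm R^o s a -> P a) -> forall a, a \in m -> P a.

Lemma maximal_prime_sm : prime_sm (ideal_sm m).
Proof. by split=> [|a b]; [apply: ideal_sm1 | apply: maximal_prime]. Qed.

Lemma regseq_zero_dim s :
  krull_dim R (size s) -> regseq R^o s -> zero_dim s.
Proof.
move=> [_ dimR] reg_s P PP sP a am; apply: contrapT => Pa.
have [c [chain_c cP]] := regseq_chain PP (local_noeth mP) reg_s sP.
have [||c' [chain_c' _]] :=
    prime_chain_extend (p := prime_of maximal_prime_sm) chain_c.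
- rewrite cP => b /prime_ofP Pb; apply/prime_ofP.
  exact: proper_sub_maximal (proj1 PP) Pb.
- by rewrite cP => /(_ a) mPa; apply/Pa/(prime_ofP PP)/mPa/prime_ofP.
- by have := dimR _ _ chain_c'; rewrite ltnn.
Qed.

Lemma socle_neq0 (M : lmodType R) (N : submod M) s v :
    zero_dim s -> (forall a u, seq_sm R^o s a -> N (a *: u)) -> ~ N v ->
  exists u, ~ N u /\ socle m N u.
Proof.
move=> s0 sN Nv.
have [u [maxu vu]] := maximal_ann_ex (local_noeth mP) Nv.
exists u; split; first by case: maxu.
move=> a am; apply: (s0 (ann N u)) am; first exact: maximal_ann_prime.
by move=> b sb; apply/vu/sN.
Qed.

End Dimension.

(** * Ext from the residue field *)

Section HomMx.
Variables (R : comNzRingType) (M : lmodType R).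

Lemma hom_mxM p q n (A : 'M[R]_(p, q)) (B : 'M[R]_(q, n)) (f : 'I_n -> M) j :
  hom_mx (A *m B) f j = hom_mx A (hom_mx B f) j.
Proof.
rewrite /hom_mx; under [RHS]eq_bigr do rewrite scaler_sumr.
rewrite exchange_big; apply: eq_bigr => k _; rewrite mxE scaler_suml.
by apply: eq_bigr => l _; rewrite scalerA.
Qed.

Lemma hom_mxZf p n (A : 'M[R]_(p, n)) a (f : 'I_n -> M) j :
  hom_mx A (fun k => a *: f k) j = a *: hom_mx A f j.
Proof.
by rewrite scaler_sumr; apply: eq_bigr => k _; rewrite !scalerA mulrC.
Qed.

Lemma hom_mxBf p n (A : 'M[R]_(p, n)) (f g : 'I_n -> M) j :
  hom_mx A (fun k => f k - g k) j = hom_mx A f j - hom_mx A g j.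
Proof. by rewrite -sumrB; apply: eq_bigr => k _; rewrite scalerBr. Qed.

Lemma hom_mx_sumf p n r (A : 'M[R]_(p, n)) (f : 'I_r -> 'I_n -> M) j :
  hom_mx A (fun k => \sum_a f a k) j = \sum_a hom_mx A (f a) j.
Proof.
by rewrite /hom_mx exchange_big; apply: eq_bigr => k _; rewrite scaler_sumr.
Qed.

Lemma hom_mxB p n (A B : 'M[R]_(p, n)) (f : 'I_n -> M) j :
  hom_mx (A - B) f j = hom_mx A f j - hom_mx B f j.
Proof.
by rewrite /hom_mx -sumrB; apply: eq_bigr => k _; rewrite !mxE scalerBl.
Qed.

Lemma hom_mx_scalar n x (f : 'I_n -> M) j : hom_mx x%:M f j = x *: f j.
Proof.
rewrite /hom_mx (bigD1 j) //= mxE eqxx big1 ?addr0 // => k kj.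
by rewrite mxE eq_sym (negPf kj) scale0r.
Qed.

Lemma hom_mx0 p n (f : 'I_n -> M) (j : 'I_p) : hom_mx 0 f j = 0.
Proof. by rewrite /hom_mx big1 // => k _; rewrite mxE scale0r. Qed.

Lemma sm_hom_mx (N : submod M) p n (A : 'M[R]_(p, n)) (f : 'I_n -> M) j :
  (forall k, N (f k)) -> N (hom_mx A f j).
Proof. by move=> Nf; apply: sm_sum => k; apply: smZ. Qed.

End HomMx.

Section Resolution.
Variables (R : comNzRingType) (V : lmodType R) (F : free_resolution V).

Lemma diff_diff i : diff F i.+1 *m diff F i = 0.
Proof.
apply/row_matrixP=> j; rewrite row_mul row0; apply/diff_ker.
by exists (delta_mx 0 j); rewrite rowE.
Qed.

Lemma diff_lift i n (B : 'M[R]_(n, rk F i.+1)) :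
  B *m diff F i = 0 -> exists h, B = h *m diff F i.+1.
Proof.
move=> B0; have [j|h hP] := choice (Y := 'rV[R]_(rk F i.+2))
    (P := fun j u => row j B = u *m diff F i.+1) _.
  by apply/diff_ker; rewrite -row_mul B0 row0.
exists (\matrix_j h j); apply/row_matrixP=> j.
by rewrite row_mul rowK.
Qed.

Section Cochains.
Variables (M : lmodType R) (N : submod M).

Definition cocycle_mod i (f : 'I_(rk F i) -> M) :=
  forall j, N (hom_mx (diff F i) f j).

Definition coboundary_mod i : ('I_(rk F i) -> M) -> Prop :=
  match i return ('I_(rk F i) -> M) -> Prop with
  | 0 => fun f => forall j, N (f j)
  | i'.+1 => fun f => exists g, forall j, N (f j - hom_mx (diff F i') g j)
  end.

Definition ext_zero i :=
  forall f : 'I_(rk F i) -> M, cocycle_mod f -> coboundary_mod f.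

Definition ext_span i r := exists z : 'I_r -> 'I_(rk F i) -> M,
  (forall a, cocycle_mod (z a)) /\
  forall f : 'I_(rk F i) -> M, cocycle_mod f ->
    exists c, coboundary_mod (fun j => f j - \sum_a c a *: z a j).

Lemma coboundary_mod_ext i (f f' : 'I_(rk F i) -> M) :
  (forall j, f j = f' j) -> coboundary_mod f -> coboundary_mod f'.
Proof.
case: i f f' => [|i] f f' ff'; first by move=> Nf j; rewrite -ff'.
by move=> [g Ng]; exists g => j; rewrite -ff'.
Qed.

Lemma ext_span0 i : ext_span i 0 <-> ext_zero i.
Proof.
split=> [[z [_ zP]] f /zP [c]|zero_i].
  by apply: coboundary_mod_ext => j; rewrite big_ord0 subr0.
exists (fun _ _ => 0); split=> [[]//|f /zero_i f0]; exists (fun=> 0).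
by apply: coboundary_mod_ext f0 => j; rewrite big_ord0 subr0.
Qed.

End Cochains.
End Resolution.

Lemma ext_dim_span (R : comNzRingType) (m : idealr R) i (M : lmodType R) r :
  ext_dim m i M r -> exists F : free_resolution {ideal_quot m},
    ext_span F (zero_sm M) i r.
Proof.
move=> [F [z [zc zP _]]]; exists F, z; split=> // f /zP [c cP]; exists c.
case: i f z zc zP cP => [|i] f z zc zP /=; first by [].
by move=> [g gP]; exists g => j; rewrite gP subrr.
Qed.

Section ResidueField.
Local Open Scope quotient_scope.
Variables (R : comNzRingType) (m : idealr R).
Variable F : free_resolution {ideal_quot m}.

Lemma pi_eq0 (a : R) : \pi_({ideal_quot m}) a = 0 <-> a \in m.
Proof.
rewrite -[0](rmorph0 (\pi_({ideal_quot m}))) -[in X in _ <-> X](subr0 a).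
by rewrite Quotient.idealrBE; split=> [->|/eqP].
Qed.

Lemma residue_scale (a : R) (v : {ideal_quot m}) : a \in m -> a *: v = 0.
Proof.
by move=> /pi_eq0 a0; rewrite /GRing.scale /= /quot_scale a0 mul0r.
Qed.

(** Multiplication by an element of [m] is zero on the residue field, hence
    null homotopic on its resolution. *)
Lemma homotopy0 x : x \in m ->
  exists h : 'M[R]_(rk F 0, rk F 1), h *m diff F 0 = x%:M.
Proof.
move=> xm; have [j|h hP] := choice (Y := 'rV[R]_(rk F 1))
    (P := fun j u => row j x%:M = u *m diff F 0) _.
  by apply/aug_ker; rewrite rowE mul_mx_scalar linearZ_LR residue_scale.
by exists (\matrix_j h j); apply/row_matrixP=> j; rewrite row_mul rowK hP.
Qed.

Lemma homotopyS x i (h : 'M[R]_(rk F i, rk F i.+1)) :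
    diff F i *m h *m diff F i = x *: diff F i ->
  exists h' : 'M[R]_(rk F i.+1, rk F i.+2),
    h' *m diff F i.+1 = x%:M - diff F i *m h.
Proof.
move=> hP; have [|h' ->] := @diff_lift _ _ F i _ (x%:M - diff F i *m h).
  by rewrite mulmxBl mul_scalar_mx hP subrr.
by exists h'.
Qed.

Lemma homotopy x i : x \in m -> exists h : 'M[R]_(rk F i, rk F i.+1),
  diff F i *m h *m diff F i = x *: diff F i.
Proof.
move=> xm; elim: i => [|i [h hP]].
  by have [h hP] := homotopy0 xm; exists h; rewrite -mulmxA hP mul_mx_scalar.
have [h' h'P] := homotopyS hP; exists h'.
by rewrite -mulmxA h'P mulmxBr mul_mx_scalar mulmxA diff_diff mul0mx subr0.
Qed.

Section Coefficients.
Variable M : lmodType R.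
Implicit Type N : submod M.

Lemma ext_killed N x i (f : 'I_(rk F i) -> M) :
  x \in m -> cocycle_mod N f -> coboundary_mod N (fun j => x *: f j).
Proof.
move=> xm; case: i f => [|i] f fc.
  have [h hP] := homotopy0 xm => j.
  by rewrite -hom_mx_scalar -hP hom_mxM; apply: sm_hom_mx.
have [h hP] := homotopy i xm; have [h' h'P] := homotopyS hP.
exists (hom_mx h f) => j.
rewrite -hom_mxM -hom_mx_scalar -hom_mxB -h'P hom_mxM.
exact: sm_hom_mx.
Qed.

Lemma ext_zero0 N x : x \in m -> regular N x -> ext_zero F N 0.
Proof. by move=> xm reg_x f /(ext_killed xm) /= Nxf j; apply/reg_x/Nxf. Qed.

(** The long exact sequence of multiplication by [x] on [M / N]. *)
Lemma ext_zeroS N x i : x \in m -> regular N x ->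
  ext_zero F (addimg N x) i -> ext_zero F N i.+1.
Proof.
move=> xm reg_x zero_i f fc; have [u uP] := ext_killed xm fc.
have uc : cocycle_mod (addimg N x) u.
  move=> j; have Nu := uP j; rewrite -[hom_mx _ _ _](subKr (x *: f j)).
  by apply: smB; [apply: addimg_img | apply: addimg_sub].
suff [h hP] : exists h, forall j, N (hom_mx (diff F i) u j -
                                     x *: hom_mx (diff F i) h j).
  exists h => j; apply: reg_x; rewrite scalerBr.
  exact: sm_trans (uP j) (hP j).
have addimgP (w : 'I_(rk F i) -> M) : (forall j, addimg N x (w j)) ->
    exists h, forall j, N (w j - x *: h j).
  move=> /= /(_ _) wP; have [//|h hP] := choice (Y := M)
    (P := fun j t => N (w j - x *: t)) _; last by exists h.
  by move=> j; have [n [t [Nn ->]]] := wP j; exists t; rewrite addrK.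
case: i u f fc uP uc zero_i addimgP => [|i] u f fc uP uc zero_i addimgP.
  have [h hP] := addimgP u (zero_i u uc); exists h => j.
  by rewrite -hom_mxZf -hom_mxBf; apply: sm_hom_mx.
have [v vP] := zero_i u uc; have [h hP] := addimgP _ vP; exists h => j.
have -> : hom_mx (diff F i.+1) u j =
    hom_mx (diff F i.+1) (fun k => u k - hom_mx (diff F i) v k) j.
  by rewrite hom_mxBf -hom_mxM diff_diff hom_mx0 subr0.
by rewrite -hom_mxZf -hom_mxBf; apply: sm_hom_mx.
Qed.

(** Lifting to [M / N] a cocycle with values in [M / (N + xM)] and applying
    the differential gives [x] times a cocycle of the next degree. *)
Lemma ext_span_shift N x i r : x \in m -> regular N x ->
  ext_zero F N i -> ext_span F N i.+1 r -> ext_span F (addimg N x) i r.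
Proof.
move=> xm reg_x zero_i [z [zc zP]].
have [u uP] := choice (fun a => ext_killed xm (zc a)).
exists u; split=> [a j|f fc].
  rewrite -[hom_mx _ _ _](subKr (x *: z a j)).
  by apply: smB; [apply: addimg_img | apply/addimg_sub/uP].
have [j|g gP] := choice (Y := M)
    (P := fun j t => N (hom_mx (diff F i) f j - x *: t)) _.
  by have [n [t [Nn ->]]] := fc j; exists t; rewrite addrK.
have [|c [h hP]] := zP g.
  move=> j; apply: reg_x; rewrite -hom_mxZf.
  suff -> : hom_mx (diff F i.+1) (fun k => x *: g k) j =
      - hom_mx (diff F i.+1) (fun k => hom_mx (diff F i) f k - x *: g k) j.
    by apply/smN/sm_hom_mx.
  by rewrite hom_mxBf -hom_mxM diff_diff hom_mx0 sub0r opprK.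
exists c; pose f' j := f j - \sum_a c a *: u a j - x *: h j.
have f'c : cocycle_mod N f'.
  move=> j; rewrite hom_mxBf hom_mxBf hom_mxZf hom_mx_sumf.
  under eq_bigr do rewrite hom_mxZf.
  have -> : hom_mx (diff F i) f j - \sum_a c a *: hom_mx (diff F i) (u a) j -
      x *: hom_mx (diff F i) h j =
    (hom_mx (diff F i) f j - x *: g j) +
    \sum_a c a *: (x *: z a j - hom_mx (diff F i) (u a) j) +
    x *: (g j - \sum_a c a *: z a j - hom_mx (diff F i) h j).
    under [in RHS]eq_bigr do rewrite scalerBr scalerA mulrC -scalerA.
    rewrite sumrB -scaler_sumr; module R.
  apply: smD; last by apply/smZ/hP.
  apply: smD; first exact: gP.
  by apply: sm_sum => a; apply/smZ/uP.
have := zero_i f' f'c; rewrite /f'.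
case: (i) f u h {f' f'c g gP hP fc z zc zP uP zero_i} => [|k] f u h /=.
  move=> Nf j; rewrite -[_ - _](subrK (x *: h j)).
  by apply: (@smD _ _ (addimg N x)); [apply: addimg_sub | apply: addimg_img].
move=> [g Ng]; exists g => j; rewrite -[_ - _ - _](subrK (x *: h j)).
by apply: (@smD _ _ (addimg N x));
  [rewrite addrAC; apply: addimg_sub | apply: addimg_img].
Qed.

Lemma regseq_cat p q : regseq M (p ++ q) -> regseq M q.
Proof. by elim: p => //= x p IHp [_ /IHp]. Qed.

(** Passing to the quotient by the first element of the sequence lowers the
    degree by one; in degree zero this element kills the cocycles and is
    regular. *)
Lemma ext_zero_regseq p q k : {subset p ++ q <= m} -> regseq M (p ++ q) ->
  (k < size p)%N -> ext_zero F (seq_sm M q) k.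
Proof.
elim/last_ind: p q k => [//|p x IHp] q k; rewrite size_rcons cat_rcons.
move=> pqm pq_reg; have [reg_x _] := regseq_cat pq_reg.
have xm : x \in m by apply: pqm; rewrite mem_cat mem_head orbT.
case: k => [_|k kp]; first exact: ext_zero0 reg_x.
by apply: ext_zeroS reg_x _ => //; apply: (IHp (x :: q)).
Qed.

Lemma ext_span_regseq s j r : {subset s <= m} -> regseq M s ->
    (forall k, (k < j + size s)%N -> ext_zero F (zero_sm M) k) ->
    ext_span F (zero_sm M) (j + size s) r ->
  ext_span F (seq_sm M s) j r.
Proof.
elim: s j r => [|x s IHs] j r /=; first by rewrite addn0.
move=> sm [reg_x reg_s] van spn.
have sm' : {subset s <= m} by move=> y ys; apply: sm; rewrite inE ys orbT.
apply: ext_span_shift => //; first exact/sm/mem_head.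
  apply/ext_span0/IHs => // [k kj|]; last apply/ext_span0; apply: van.
    by rewrite addnS ltnS ltnW.
  by rewrite addnS.
by apply: IHs => //; [rewrite addSnnS | rewrite addSnnS].
Qed.

(** In degree zero cocycles are homomorphisms from the residue field. *)
Lemma ext_span_socle N r : ext_span F N 0 r -> exists s : 'I_r -> M,
  (forall a, socle m N (s a)) /\
  forall v, socle m N v -> exists c, N (v - \sum_a c a *: s a).
Proof.
move=> [z [zc zP]].
have [v1 v1P] := aug_surj F (\pi_({ideal_quot m}) 1).
have augZ (a : R) (w : {ideal_quot m}) :
  a *: w = \pi_({ideal_quot m}) a * w by [].
exists (fun a => \sum_j v1 0 j *: z a j); split=> [a b bm|v soc_v].
  have /aug_ker [u uP] : aug F (b *: v1) = 0.
    by rewrite linearZ_LR residue_scale.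
  rewrite scaler_sumr.
  suff -> : \sum_j b *: (v1 0 j *: z a j) =
      hom_mx u (hom_mx (diff F 0) (z a)) 0 by apply/sm_hom_mx/zc.
  by rewrite -hom_mxM -uP; apply: eq_bigr => j _; rewrite mxE scalerA.
pose e j := repr (aug F (delta_mx 0 j)).
have augE (w : 'rV_(rk F 0)) :
    aug F w = \pi_({ideal_quot m}) (\sum_j w 0 j * e j).
  rewrite {1}[w]row_sum_delta linear_sum rmorph_sum; apply: eq_bigr => j _.
  by rewrite linearZ_LR rmorphM /= augZ reprK.
have [j|c cP] := zP (fun j => e j *: v).
  rewrite /hom_mx; under eq_bigr do rewrite scalerA.
  rewrite -scaler_suml; apply: soc_v; apply/pi_eq0.
  rewrite -[RHS](_ : aug F (row j (diff F 0)) = 0).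
    rewrite augE; congr (\pi_({ideal_quot m}) _).
    by apply: eq_bigr => k _; rewrite mxE.
  by apply/aug_ker; exists (delta_mx 0 j); rewrite rowE.
exists c; have e1 : 1 - \sum_j v1 0 j * e j \in m.
  by apply/pi_eq0; rewrite rmorphB /= -augE -v1P subrr.
suff -> : v - \sum_a c a *: \sum_j v1 0 j *: z a j =
    (1 - \sum_j v1 0 j * e j) *: v +
    \sum_j v1 0 j *: (e j *: v - \sum_a c a *: z a j).
  by apply: smD; [apply: soc_v | apply: sm_sum => j; apply/smZ/cP].
have -> : \sum_j v1 0 j *: (e j *: v - \sum_a c a *: z a j) =
    (\sum_j v1 0 j * e j) *: v - \sum_j v1 0 j *: \sum_a c a *: z a j.
  rewrite scaler_suml -sumrB; apply: eq_bigr => j _.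
  by rewrite scalerBr scalerA.
rewrite scalerBl scale1r addrA subrK; congr (_ - _).
under eq_bigr do rewrite scaler_sumr.
rewrite exchange_big; apply: eq_bigr => j _; rewrite scaler_sumr.
by apply: eq_bigr => a _; rewrite !scalerA mulrC.
Qed.

End Coefficients.
End ResidueField.

(** * Endomorphisms of [M / N] *)

Section Endomorphisms.
Variables (R : comNzRingType) (m : idealr R) (mP : local_ring m).
Variable M : lmodType R.
Implicit Type N : submod M.

(** [phi] induces an endomorphism of [M / N]. *)
Definition endo N (phi : M -> M) :=
  (forall a u v, N (phi (a *: u + v) - (a *: phi u + phi v))) /\
  forall v, N v -> N (phi v).

Definition scalar_endos N := forall phi, endo N phi ->
  exists c, forall v, N (phi v - c *: v).

Lemma endo_scale N c : endo N (fun v => c *: v).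
Proof.
split=> [a u v|v]; last exact: smZ.
by rewrite (_ : _ - _ = 0); [apply: sm0 | module R].
Qed.

Lemma endoB N phi psi :
  endo N phi -> endo N psi -> endo N (fun v => phi v - psi v).
Proof.
move=> [phiP phiN] [psiP psiN]; split=> [a u v|v Nv]; last first.
  by apply: smB; [apply: phiN | apply: psiN].
have := smB (phiP a u v) (psiP a u v); congr (sm_car _ _); module R.
Qed.

Lemma endoZ N phi a v : endo N phi -> N (phi (a *: v) - a *: phi v).
Proof.
move=> [phiP phiN]; have := smD (phiP a v 0) (phiN 0 (sm0 N)).
by rewrite addr0; congr (sm_car _ _); module R.
Qed.

Lemma endo_eq_gen N phi psi n (g : 'I_n -> M) :
    (forall v, exists c, v = \sum_i c i *: g i) -> endo N phi -> endo N psi ->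
  (forall i, N (phi (g i) - psi (g i))) -> forall v, N (phi v - psi v).
Proof.
move=> gP phiE psiE eq_g v; have [c ->] := gP v.
have [thetaP thetaN] := endoB phiE psiE.
elim/big_rec: _ => [|i u _ Nu]; first exact/thetaN/sm0.
apply/(sm_congr (thetaP (c i) (g i) u)).
by apply: smD => //; apply: smZ.
Qed.

Lemma endo_div N x phi : regular N x -> endo N phi ->
    (forall v, addimg N x (phi v)) ->
  exists2 psi, endo N psi & forall v, N (phi v - x *: psi v).
Proof.
move=> reg_x [phiP phiN] phix.
have [v|psi psiP] := choice (Y := M) (P := fun v t => N (phi v - x *: t)) _.
  by have [n [t [Nn ->]]] := phix v; exists t; rewrite addrK.
exists psi => //; split=> [a u v|v Nv]; apply: reg_x; last first.
  by apply/(sm_congr (psiP v)); apply: phiN.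
have := smB (phiP a u v) (smB (psiP (a *: u + v)) (smZD a (psiP u) (psiP v))).
by congr (sm_car _ _); module R.
Qed.

(** If [R / (s)] has dimension zero and the socle of [M / (s)M] is cyclic,
    then [M / (s)M] embeds in the injective hull of the residue field, and its
    endomorphisms are scalars. The proof replaces the injective hull by an
    induction along a composition series of [R / (s)]: an endomorphism that
    vanishes on the elements killed by [J] is multiplication by an element
    of [J]. *)
Lemma scalar_endos_socle s t : zero_dim m s -> socle m (seq_sm M s) t ->
    (forall v, socle m (seq_sm M s) v -> exists c, seq_sm M s (v - c *: t)) ->
  scalar_endos (seq_sm M s).
Proof.
set N := seq_sm M s => s0 soc_t t_soc.
have nR := local_noeth mP.
pose killed (J : submod R^o) v := forall a : R, J a -> N (a *: v).
have [|J [[sJ JP] maxJ]] := nR (fun J : submod R^o =>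
    (forall a, seq_sm R^o s a -> J a) /\ forall phi, endo N phi ->
    (forall v, killed J v -> N (phi v)) ->
    exists c : R, J c /\ forall v, N (phi v - c *: v)).
  exists (seq_sm R^o s); split=> // phi phiE phi0.
  exists 0; split=> [|v]; first exact: (@sm0 _ R^o).
  by rewrite scale0r subr0; apply: phi0 => a; apply: seq_sm_ideal.
have [J1 phi phiE|J1] := pselect (J 1).
  have [v /(_ 1 J1)|c [_ cP]] := JP phi phiE; last by exists c.
  by rewrite scale1r; apply: phiE.2.
have [|c [Jc soc_c]] := @socle_neq0 _ _ mP R^o J s 1 s0 _ J1.
  move=> a u sa; have := @smM R J u a (sJ a sa).
  by rewrite (_ : a *: u = (u : R) * a) //; apply: mulrC.
case: Jc; apply: (maxJ (addspan J c)); last exact: addspan_gen.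
  split=> [a /sJ|phi phiE phi0]; first exact: addspan_sub.
  have killedS v : killed J v -> N (c *: v) -> killed (addspan J c) v.
    move=> Jv Ncv a [b [d [Jb ->]]].
    have := smD (Jv b Jb) (smZ d Ncv); congr (sm_car _ _).
    by rewrite scalerDl scalerA.
  have [Jc0|/existsNP [v0 /not_implyP [Jv0 Ncv0]]] :=
    pselect (forall v, killed J v -> N (c *: v)).
    have [v Jv|d [Jd dP]] := JP phi phiE; last first.
      by exists d; split=> //; apply: addspan_sub.
    by apply: phi0; apply: killedS => //; apply: Jc0.
  have soc_cv v : killed J v -> socle m N (c *: v).
    move=> Jv a am; have := Jv _ (soc_c a am); congr (sm_car _ _).
    by rewrite scalerA.
  have [b bP] := t_soc _ (soc_cv v0 Jv0).
  have bm : b \notin m.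
    apply/negP => bm; apply: Ncv0; apply/(sm_congr bP); exact: soc_t.
  have [b' b'b] := local_unit mP bm.
  have t_cv0 : N (t - b' *: (c *: v0)).
    have := smZ (- b') bP; congr (sm_car _ _).
    by rewrite scalerBr (scalerA _ b) mulNr b'b; module R.
  have [e eP] : exists e, N (phi v0 - e *: t).
    apply: t_soc => a am; apply/(sm_congr (smBC (endoZ a v0 phiE))).
    apply: phi0; apply: killedS => [d Jd|].
      by rewrite scalerA mulrC -scalerA; apply/smZ/Jv0.
    by rewrite scalerA mulrC -scalerA; apply: soc_cv.
  pose f := e * b'.
  have fP : N (phi v0 - f *: (c *: v0)).
    have := smD eP (smZ e t_cv0); congr (sm_car _ _); rewrite /f; module R.
  have [||d [Jd dP]] := JP (fun v => phi v - (f * c) *: v).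
  - exact: endoB phiE (endo_scale N _).
  - move=> v Jv; have [g gP] := t_soc _ (soc_cv v Jv).
    pose h := g * b'.
    have hP : N (c *: v - h *: (c *: v0)).
      have := smD gP (smZ g t_cv0); congr (sm_car _ _); rewrite /h; module R.
    have : N (phi (v - h *: v0)).
      apply: phi0; apply: killedS => [a Ja|].
        have := smB (Jv a Ja) (smZ h (Jv0 a Ja)); congr (sm_car _ _).
        module R.
      by move: hP; congr (sm_car _ _); module R.
    rewrite (_ : v - h *: v0 = (- h) *: v0 + v); last by module R.
    move=> phi_vh0; have phi_vh := phiE.1 (- h) v0 v.
    have := smB (smD (smB phi_vh0 phi_vh) (smZ h fP)) (smZ f hP).
    congr (sm_car _ _); module R.
  - exists (d + f * c); split.
      by exists d, f; split.
    by move=> v; have := dP v; congr (sm_car _ _); module R.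
by move=> a; apply: addspan_sub.
Qed.

End Endomorphisms.

Section Descent.
Variables (R : comNzRingType) (m : idealr R) (mP : local_ring m).
Variable M : lmodType R.
Implicit Type N : submod M.

Section Power.
Variables (n : nat) (N : submod M).
Fact power_closed a (f g : {ffun 'I_n -> M}) :
  (forall i, N (f i)) -> (forall i, N (g i)) -> forall i, N ((a *: f + g) i).
Proof. by move=> Nf Ng i; rewrite !ffunE; apply: smZD. Qed.
Fact power0 : forall i, N ((0 : {ffun 'I_n -> M}) i).
Proof. by move=> i; rewrite ffunE; apply: sm0. Qed.
Definition power_sm := @Submod R {ffun 'I_n -> M}
  (fun f => forall i, N (f i)) power0 power_closed.
End Power.

(** Nakayama's lemma for the ring of endomorphisms of [M / N], which is
    generated by [1] and its multiples by [x]. An endomorphism is determined by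
    its values at generators of [M], so that the submodules [R + R psi] satisfy
    the maximum condition; [psi = c + x chi] at a maximal one gives
    [chi] in [R + R psi]. *)
Lemma scalar_endos_addimg N x : noeth M -> x \in m -> regular N x ->
  scalar_endos (addimg N x) -> scalar_endos N.
Proof.
move=> nM xm reg_x scal phi phiE.
have [gs gsP] := noeth_fg (full_sm M) nM; pose n := size gs.
pose g (i : 'I_n) := gs`_i.
have gP v : exists c, v = \sum_i c i *: g i by have [+ _] := gsP v; apply.
pose ev (psi : M -> M) : {ffun 'I_n -> M} := [ffun i => psi (g i)].
pose L psi := addspan (addspan (power_sm n N) (ev id)) (ev psi).
have [|U [[psi [psiE [a [b phi_ab]] ->]] maxU]] := noeth_ffun (n := n) nM
    (P := fun U => exists psi, [/\ endo N psi,
      exists a b, forall v, N (phi v - (a *: v + b *: psi v)) & U = L psi]).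
  exists (L phi), phi; split=> //; exists 0, 1 => v.
  by rewrite (_ : _ - _ = 0); [apply: sm0 | module R].
have psi_mod : endo (addimg N x) psi.
  split=> [c u v|v [u [t [Nu ->]]]]; first exact/addimg_sub/psiE.1.
  have := smD (addimg_sub x (smD (psiE.1 x t u) (psiE.2 u Nu)))
              (addimg_img N x (psi t)).
  by rewrite addrC [u + _]addrC; congr (sm_car _ _); module R.
have [c cP] := scal psi psi_mod.
have [chi chiE chiP] := endo_div reg_x (endoB psiE (endo_scale N c)) cP.
have [p [q pq]] : exists p q,
    forall i, N (chi (g i) - (p *: g i + q *: psi (g i))).
  have [] : L psi (ev chi).
    apply: (maxU (L chi)); last exact: addspan_gen.
      exists chi; split=> //; exists (a + b * c), (b * x) => v.
      by have := smD (phi_ab v) (smZ b (chiP v)); congr (sm_car _ _); module R.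
    move=> f [_ [d [[f' [e [Nf' ->]]] ->]]].
    pose f1 := f' + d *: (ev psi - c *: ev id - x *: ev chi).
    exists (f1 + (e + d * c) *: ev id), (d * x); split; last first.
      by rewrite /f1; module R.
    exists f1, (e + d * c).
    split=> // i; have := smD (Nf' i) (smZ d (chiP (g i))).
    by rewrite !ffunE.
  move=> _ [q [[f [p [Nf ->]]] evE]]; exists p, q => i.
  have := congr1 (fun h : {ffun 'I_n -> M} => h i) evE.
  rewrite !ffunE => ->; have := Nf i; congr (sm_car _ _); module R.
have [u u1] := local_sub1_unit mP (idealMr q xm).
pose d := u * (p + q * c).
have chi_d v : N (chi v - d *: v).
  apply: (endo_eq_gen gP chiE (endo_scale N d)) => i.
  have := smZ u (smD (pq i) (smZ q (chiP (g i)))); congr (sm_car _ _).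
  rewrite -[RHS](_ : (u * (1 - q * x)) *: chi (g i) - d *: g i = _).
    by rewrite /d; module R.
  by rewrite u1 scale1r.
exists (a + b * c + b * x * d) => v.
have := smD (phi_ab v) (smD (smZ b (chiP v)) (smZ (b * x) (chi_d v))).
congr (sm_car _ _); module R.
Qed.

(** An element [c] with [cM] in [N + xM] defines an endomorphism of [M / N]
    divisible by [x], whose quotient by [x] is again a scalar. *)
Lemma faithful_addimg (I : submod R^o) N x : regular N x -> scalar_endos N ->
    (forall c, (forall v, N (c *: v)) -> I c) ->
  forall c, (forall v, addimg N x (c *: v)) -> addimg I x c.
Proof.
move=> reg_x scal faith c cP.
have [psi psiE psiP] := endo_div reg_x (endo_scale N c) cP.
have [b bP] := scal psi psiE.
exists (c - x * b), b; split; last by apply/esym/subrK.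
apply: faith => v; have := smD (psiP v) (smZ x (bP v)).
congr (sm_car _ _); module R.
Qed.

Lemma regseq_scalar_faithful s :
    noeth M -> {subset s <= m} -> regseq M s ->
    (forall c : R, (forall v : M, c *: v = 0) -> c = 0) ->
    scalar_endos (seq_sm M s) ->
  scalar_endos (zero_sm M) /\
  forall c, (forall v, seq_sm M s (c *: v)) -> seq_sm R^o s c.
Proof.
move=> nM + + faith; elim: s => [//|x s IHs] sm /= [reg_x reg_s] scal.
have xm : x \in m by apply/sm/mem_head.
have sm' : {subset s <= m} by move=> y ys; apply: sm; rewrite inE ys orbT.
have scal' := scalar_endos_addimg nM xm reg_x scal.
have [scal0 faith_s] := IHs sm' reg_s scal'.
by split=> //; apply: faithful_addimg.
Qed.

(** * Number of generators *)

Section Generators.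
Variables (s : seq R) (t : M) (r : nat) (sigma : 'I_r -> R^o).
Let N := seq_sm M s.
Hypothesis nM : noeth M.
Hypothesis sm : {subset s <= m}.
Hypothesis Nt : ~ N t.
Hypothesis soc_t : socle m N t.
Hypothesis t_soc : forall v, socle m N v -> exists c, N (v - c *: t).
Hypothesis scal : scalar_endos N.
Hypothesis faith : forall c, (forall v, N (c *: v)) -> seq_sm R^o s c.
Hypothesis soc_sigma : forall a, socle m (seq_sm R^o s) (sigma a).
Hypothesis sigma_soc : forall c, socle m (seq_sm R^o s) c ->
  exists b, seq_sm R^o s (c - \sum_a b a *: sigma a).

(** Each [sigma a] maps [M / N] to the socle of [M / N], which is a line; the
   elements killed by the first [j] of them have codimension at most [j]. *)
Lemma sigma_codim j : (j <= r)%N -> exists2 gs : seq M, size gs = j &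
  forall v, exists2 u, gen_sm (zero_sm M) gs u &
    forall a : 'I_r, (a < j)%N -> N ((sigma a : R) *: (v - u)).
Proof.
elim: j => [|j IHj] jr.
  by exists [::] => // v; exists 0; first exact: sm0.
have [gs sz_gs gsP] := IHj (ltnW jr); pose aj := Ordinal jr.
pose K v := forall a : 'I_r, (a < j)%N -> N ((sigma a : R) *: v).
have soc_sv a v : socle m N ((sigma a : R) *: v).
  move=> b bm; rewrite scalerA; apply: seq_sm_ideal; exact: soc_sigma.
have [v0 Kv0 v0P] : exists2 v0, K v0 & forall w, K w ->
    exists d, N ((sigma aj : R) *: (w - d *: v0)).
  have [K0|/existsNP [v0 /not_implyP [Kv0 Nv0]]] :=
      pselect (forall v, K v -> N ((sigma aj : R) *: v)).
    exists 0 => [a _|w Kw]; first by rewrite scaler0; apply: sm0.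
    by exists 0; rewrite scaler0 subr0; apply: K0.
  exists v0 => // w Kw.
  have [b bP] := t_soc (soc_sv aj v0); have [c cP] := t_soc (soc_sv aj w).
  have bm : b \notin m.
    by apply/negP => bm; apply/Nv0/(sm_congr bP)/soc_t.
  have [b' b'b] := local_unit mP bm; exists (c * b').
  have := smB cP (smZ (c * b') bP); congr (sm_car _ _).
  rewrite [in LHS](scalerBr (c * b')) (scalerA _ b) -[c * b' * b]mulrA b'b.
  rewrite mulr1.
  module R.
exists (v0 :: gs) => [|v]; first by rewrite /= sz_gs.
have [u gs_u Kvu] := gsP v; have [d dP] := v0P _ Kvu.
exists (u + d *: v0); first by exists u, d.
move=> a; rewrite ltnS leq_eqVlt => /orP[/eqP aj_eq|aj_lt].
  have -> : a = aj by apply: val_inj.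
  by move: dP; congr (sm_car _ _); module R.
have := smB (Kvu a aj_lt) (smZ d (Kv0 a aj_lt)); congr (sm_car _ _).
module R.
Qed.

(** A functional on [M / mM] composed with the inclusion of the socle is an
    endomorphism of [M / N], that is, an element of the socle of [R / (s)];
    it vanishes where every [sigma a] does. So the elements killed by every
    [sigma a] lie in [mM], and Nakayama's lemma applies. *)
Lemma generators_le : exists2 gs : seq M, size gs = r &
  forall v, gen_sm (zero_sm M) gs v.
Proof.
have [gs sz_gs gsP] := sigma_codim (leqnn r); exists gs => // v0.
apply: contrapT => /(maximal_submod mP nM) [L [gsL [v Lv] Lmax mL]].
have [u gs_u Kvu] := gsP v; set k := v - u in Kvu.
have Lk : ~ L k.
  by move=> Lk; apply: Lv; rewrite -[v](subrK u); apply: smD => //; apply: gsL.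
have [w|alpha alphaP] := choice (Y := R) (P := fun w a => L (w - a *: k)) _.
  by have [l [a [Ll ->]]] := Lmax k Lk w; exists a; rewrite addrK.
have in_m a : L (a *: k) -> a \in m.
  move=> Lak; apply: contrapT => /negP /(local_unit mP) [b ba].
  by apply: Lk; rewrite -[k]scale1r -ba -scalerA; apply: smZ.
have NL w : N w -> L w by apply: (seq_sm_sub sm).
have alpha_m w : L w -> alpha w \in m.
  move=> Lw; apply: in_m; have := smB Lw (alphaP w).
  by congr (sm_car _ _); module R.
have phiE : endo N (fun w => alpha w *: t).
  split=> [a w w'|w Nw]; last by apply/soc_t/alpha_m/NL.
  suff : alpha (a *: w + w') - (a * alpha w + alpha w') \in m.
    by move/soc_t; congr (sm_car _ _); module R.
  apply: in_m.
  have := smB (smZD a (alphaP w) (alphaP w')) (alphaP (a *: w + w')).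
  by congr (sm_car _ _); module R.
have [c cP] := scal phiE.
have /sigma_soc [b bP] : socle m (seq_sm R^o s) c.
  move=> a am; apply: faith => w; rewrite -[_ *: w]/((a * c) *: w).
  have := smB (soc_t (alpha_m _ (mL a w am))) (cP (a *: w)).
  by congr (sm_car _ _); module R.
have Nck : N (c *: k).
  have := smD (seq_sm_ideal k bP) _ => /(_ (\sum_a (b a *: sigma a : R) *: k)).
  rewrite -scaler_suml -scalerDl subrK; apply.
  rewrite scaler_suml; apply: sm_sum => a; rewrite -scalerA.
  exact/smZ/Kvu.
have ak : 1 - alpha k \in m.
  by apply: in_m; have := alphaP k; congr (sm_car _ _); module R.
apply: Nt; have := smD (smD (cP k) Nck) (soc_t ak).
by congr (sm_car _ _); module R.
Qed.

End Generators.
End Descent.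

(** * Common regular sequences *)

Section CommonRegseq.
Variables (R : comNzRingType) (m : idealr R) (mP : local_ring m).
Variable F : free_resolution {ideal_quot m}.

Lemma socle_eq0 (M : lmodType R) s v :
    (forall k, (k <= size s)%N -> ext_zero F (zero_sm M) k) ->
    {subset s <= m} -> regseq M s -> socle m (seq_sm M s) v ->
  seq_sm M s v.
Proof.
move=> van sm reg_s soc_v.
have /ext_span_socle [z [_ zP]] : ext_span F (seq_sm M s) 0 0.
  apply: ext_span_regseq => // [k /ltnW ks|]; first exact: van.
  by apply/ext_span0/van.
by have [c] := zP v soc_v; rewrite big_ord0 subr0.
Qed.

Lemma common_regseq (M M' : lmodType R) d :
    noeth M -> noeth M' ->
    (forall k, (k < d)%N -> ext_zero F (zero_sm M) k) ->
    (forall k, (k < d)%N -> ext_zero F (zero_sm M') k) ->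
  exists s, [/\ {subset s <= m}, size s = d, regseq M s & regseq M' s].
Proof.
move=> nM nM'; elim: d => [|d IHd] van van'; first by exists [::].
have [||s [sm sz_s reg_s reg_s']] := IHd.
- by move=> k kd; apply/van/ltnW.
- by move=> k kd; apply/van'/ltnW.
have [v|v|x [xm reg_x reg_x']] := @common_regular _ m _ _ (seq_sm M s)
    (seq_sm M' s) (local_noeth mP) nM nM'.
- by apply: socle_eq0 => // k; rewrite sz_s; apply: van.
- by apply: socle_eq0 => // k; rewrite sz_s; apply: van'.
exists (x :: s); split=> //=; last by rewrite sz_s.
by move=> y; rewrite inE => /orP[/eqP->|/sm].
Qed.

End CommonRegseq.

(** * Modules with two generators *)

Lemma finite_injdim_iso (R : comNzRingType) (M M' : lmodType R)
    (f : {linear M' -> M}) :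
    injective f -> (forall v, exists u, v = f u) ->
  finite_injdim M -> finite_injdim M'.
Proof.
move=> f_inj f_surj [n [E [e [d [injE e_inj e_ker d_ker E0]]]]].
exists n, E, (e \o f), d; split=> //; first exact: inj_comp.
move=> x; rewrite e_ker; split=> [[v ->]|[u ->]]; last by exists (f u).
by have [u ->] := f_surj v; exists u.
Qed.

Section TwoGenerators.
Variables (R : comNzRingType) (M : lmodType R) (a b : M).
Hypothesis abP : forall v, exists p q, v = p *: a + q *: b.

Definition row2_map (u : 'rV[R]_2) : M := u 0 0 *: a + u 0 1 *: b.
Fact row2_map_linear : linear row2_map.
Proof. by move=> c u v; rewrite /row2_map !mxE; module R. Qed.
HB.instance Definition _ := GRing.isLinear.Build R 'rV[R]_2 M *:%R row2_map
  row2_map_linear.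

Lemma two_gen_presentation : noeth R^o ->
  exists n (A : 'M[R]_(n, 2)), presentation A row2_map.
Proof.
move=> nR.
have [gs gsP] :=
  noeth_fg (preim_sm row2_map (zero_sm M)) (noeth_row (n := 2) nR).
exists (size gs), (\matrix_i gs`_i); split=> [v|u].
  have [p [q ->]] := abP v; exists (\row_j if j == 0 then p else q).
  by rewrite /= /row2_map !mxE.
apply: (iff_trans (gsP u)); split=> [[c ->]|[c ->]].
  exists (\row_i c i); rewrite mulmx_sum_row; apply: eq_bigr => i _.
  by rewrite mxE rowK.
exists (fun i => c 0 i); rewrite mulmx_sum_row; apply: eq_bigr => i _.
by rewrite rowK.
Qed.

(** An entry of a presentation matrix with two columns is a minor of size
    one. *)
Lemma Fitt1_entry n (A : 'M[R]_(n, 2)) i j :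
  presentation A row2_map -> Fitt 1 M (A i j).
Proof.
move=> presA; exists n, 2%N, A, row2_map; split=> //.
apply/gen_smP; apply: gen_sm_mem.
have const_incr k (l : 'I_k) : [ffun=> l] \in increasing_maps 1 k.
  rewrite mem_filter mem_enum andbT; apply/forallP => x; apply/forallP => y.
  by rewrite !ord1.
apply/allpairsP; exists ([ffun=> i], [ffun=> j]); split=> //=.
by rewrite det_mx11 mxE !ffunE.
Qed.

Lemma seq_sm_two_gen s v : seq_sm M s v ->
  exists p q, [/\ seq_sm R^o s p, seq_sm R^o s q & v = p *: a + q *: b].
Proof.
elim: s v => [|x s IHs] v /= => [->|[u [t [/IHs [p [q [sp sq ->]]] ->]]]].
  by exists 0, 0; split=> //; module R.
have [p' [q' ->]] := abP t.
exists (p + x * p'), (q + x * q'); split; last by module R.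
  by exists p, p'.
by exists q, q'.
Qed.

End TwoGenerators.

Section IdealModule.
Variables (R : idomainType) (w : submodClosed R^o).
Local Notation W := (ideal_mod w).

Definition ideal_val (v : W) : R^o := \val v.
Fact ideal_val_linear : linear ideal_val.
Proof. by move=> c u v; rewrite /ideal_val linearP. Qed.
HB.instance Definition _ := GRing.isLinear.Build R W R^o *:%R ideal_val
  ideal_val_linear.

Lemma ideal_valZ c (v : W) : ideal_val (c *: v) = c * ideal_val v.
Proof. exact: linearZ_LR. Qed.

Lemma ideal_valD (u v : W) : ideal_val (u + v) = ideal_val u + ideal_val v.
Proof. exact: linearD. Qed.

Lemma ideal_valB (u v : W) : ideal_val (u - v) = ideal_val u - ideal_val v.
Proof. exact: linearB. Qed.

Lemma ideal_val_inj : injective ideal_val.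
Proof. exact: val_inj. Qed.

Lemma ideal_val_surj x : x \in w -> exists v, ideal_val v = x.
Proof. by move=> wx; exists (exist _ x wx). Qed.

Lemma ideal_mod_torsion_free c (v : W) : c *: v = 0 -> v <> 0 -> c = 0.
Proof.
move=> cv0 v0; have := congr1 ideal_val cv0; rewrite ideal_valZ linear0.
move=> /eqP; rewrite mulf_eq0 => /orP[/eqP //|/eqP v_0].
by case: v0; apply: ideal_val_inj; rewrite v_0 linear0.
Qed.

Section Cyclic.
Variable a : W.
Definition mul_gen (c : R^o) : W := c *: a.
Fact mul_gen_linear : linear mul_gen.
Proof. by move=> c u v; rewrite /mul_gen scalerDl scalerA. Qed.
HB.instance Definition _ := GRing.isLinear.Build R R^o W *:%R mul_gen
  mul_gen_linear.

Lemma cyclic_injdim : a <> 0 -> (forall v, exists c, v = c *: a) ->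
  finite_injdim W -> finite_injdim R^o.
Proof.
move=> a0 aP; apply: (@finite_injdim_iso _ _ _ mul_gen); last exact: aP.
move=> c c' /eqP; rewrite -subr_eq0 -linearB => /eqP cc'.
by apply/eqP; rewrite -subr_eq0; apply/eqP/(ideal_mod_torsion_free cc').
Qed.
End Cyclic.

Lemma addimg_ideal (I : submod R^o) x c : addimg I x c ->
  exists i y : R, I i /\ c = i + x * y.
Proof. by move=> [i [y [Ii ->]]]; exists i, y. Qed.

Section TwoGeneratedIdeal.
Variables a b : W.
Let alpha : R := ideal_val a.
Let beta : R := ideal_val b.
Hypothesis abP : forall v, exists p q, v = p *: a + q *: b.
Hypothesis alpha0 : alpha != 0.

(** A relation with coefficients in [w] is an endomorphism of [w], namely
    multiplication by a fraction. *)
Lemma relation_scalar (x y : W) :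
    scalar_endos (zero_sm W) ->
    ideal_val x * alpha + ideal_val y * beta = 0 ->
  exists t, ideal_val x = - (t * beta) /\ ideal_val y = t * alpha.
Proof.
move=> scal xy.
have [v|phi phiP] := choice (Y := W)
    (P := fun v u => alpha * ideal_val u = ideal_val y * ideal_val v) _.
  have [p [q ->]] := abP v; exists (p *: y - q *: x).
  rewrite ideal_valB ideal_valD !ideal_valZ -/alpha -/beta.
  have -> : alpha * (p * ideal_val y - q * ideal_val x) =
    alpha * p * ideal_val y - q * (ideal_val x * alpha) by ring.
  by move/eqP: xy; rewrite addr_eq0 => /eqP ->; ring.
have inj u v : alpha * ideal_val u = alpha * ideal_val v -> u = v.
  by move=> /(mulfI alpha0) /ideal_val_inj.
have [|t tP] := scal phi.
  split=> [c u v|v ->]; last by apply: inj; rewrite phiP !linear0 !mulr0.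
  suff -> : phi (c *: u + v) = c *: phi u + phi v by apply: subrr.
  apply: inj; rewrite phiP !ideal_valD !ideal_valZ mulrDr [RHS]mulrDr phiP.
  by rewrite mulrCA [in RHS]mulrCA phiP.
have ya : ideal_val y = t * alpha.
  apply: (mulIf alpha0); rewrite -phiP.
  have -> : phi a = t *: a by apply: subr0_eq (tP a).
  by rewrite ideal_valZ mulrC.
exists t; split=> //; apply: (mulIf alpha0); move/eqP: xy.
by rewrite addr_eq0 ya => /eqP ->; ring.
Qed.

Hypothesis relations : forall p q, p *: a + q *: b = 0 ->
  exists t, p = - (t * beta) /\ q = t * alpha.

(** The injection [R -> R ^ 2] with entries [- b] and [a] stays injective
    modulo a sequence that is regular on its cokernel [w]. *)
Lemma koszul_exact s c : regseq W s -> seq_sm R^o s (c * alpha) ->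
  seq_sm R^o s (c * beta) -> seq_sm R^o s c.
Proof.
elim: s c => [|x s IHs] c /=.
  by move=> _ /eqP; rewrite mulf_eq0 (negPf alpha0) orbF => /eqP.
move=> [reg_x reg_s] /addimg_ideal [i2 [y2 [si2 e2]]].
move=> /addimg_ideal [i1 [y1 [si1 e1]]].
have [p [q [sp sq pq]]] : exists p q, [/\ seq_sm R^o s p, seq_sm R^o s q &
    (- y1) *: a + y2 *: b = p *: a + q *: b].
  apply: seq_sm_two_gen => //; apply: reg_x.
  have := smB (seq_sm_ideal a si1) (seq_sm_ideal b si2); congr (sm_car _ _).
  apply: ideal_val_inj; rewrite !(ideal_valB, ideal_valD, ideal_valZ).
  rewrite -/alpha -/beta.
  have -> : i1 = c * beta - x * y1 by rewrite e1 addrK.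
  have -> : i2 = c * alpha - x * y2 by rewrite e2 addrK.
  by ring.
have [t [tp tq]] : exists t, - y1 - p = - (t * beta) /\ y2 - q = t * alpha.
  apply: relations; rewrite -[0](subrr (p *: a + q *: b)) -{1}pq.
  module R.
exists (c - x * t), t; split; last by apply/esym/subrK.
apply: IHs => //.
  have -> : (c - x * t) * alpha = i2 + x * q.
    have -> : (c - x * t) * alpha = c * alpha - x * (t * alpha) by ring.
    by rewrite e2 -tq; ring.
  by apply: smD => //; apply: smM.
have -> : (c - x * t) * beta = i1 - x * p.
  have -> : (c - x * t) * beta = c * beta + x * (- (t * beta)) by ring.
  by rewrite e1 -tp; ring.
by apply: smB => //; apply: smM.
Qed.

End TwoGeneratedIdeal.
End IdealModule.

(** * Canonical ideals of type at most two *)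

Lemma krull_dim_inj (R : comNzRingType) d d' :
  krull_dim R d -> krull_dim R d' -> d = d'.
Proof.
move=> [[p pd] le_d] [[p' pd'] le_d']; apply/eqP.
by rewrite eqn_leq (le_d' _ _ pd) (le_d _ _ pd').
Qed.

Lemma depth_inj (R : comNzRingType) (m : idealr R) (M : lmodType R) t t' :
  depth m M t -> depth m M t' -> t = t'.
Proof.
move=> [[s [sm reg_s <-]] le_t] [[s' [sm' reg_s' <-]] le_t']; apply/eqP.
by rewrite eqn_leq le_t // le_t'.
Qed.

Lemma depth_ext_zero (R : comNzRingType) (m : idealr R) (M : lmodType R) t
    (F : free_resolution {ideal_quot m}) k :
  depth m M t -> (k < t)%N -> ext_zero F (zero_sm M) k.
Proof.
move=> [[s [sm /regular_sequence_regseq [reg_s _] <-]] _].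
rewrite -size_rev.
apply: (@ext_zero_regseq _ _ _ _ (rev s) [::]); rewrite cats0 //.
by move=> x; rewrite mem_rev; apply: sm.
Qed.

Theorem proposition2p4 (R : idomainType) (m : idealr R)
    (R_CM : cohen_macaulay m)
    (w : submodClosed R^o)
    (w_canonical : canonical_module m (ideal_mod w))
    (Fitt_w : forall x : R, Fitt 1 (ideal_mod w) x <-> x \in w)
    (r : nat) (type_R : cm_type m R^o r) (r_le2 : (r <= 2)%N) :
  gorenstein m.
Proof.
have [mP [d [dimR depR]]] := R_CM; split=> //.
have [[_ [d' [dimR' depW]]] [t' [depW' extW]] injW] := w_canonical.
have [t'' [depR' extR]] := type_R.
have ed' := krull_dim_inj dimR' dimR; have et' := depth_inj depW' depW.
have et'' := depth_inj depR' depR; subst d' t' t''.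
set W := ideal_mod w in depW extW injW w_canonical Fitt_w *.
have nR := local_noeth mP; have nW := noeth_inj (@ideal_val_inj _ w) nR.
have [v0 v0_neq0] : exists v : W, v <> 0.
  have [[s [_ /regular_sequence_regseq [_ [v sv]] _]] _] := depW.
  by exists v => v0; apply: sv; rewrite v0; apply: sm0.
have [FW spanW] := ext_dim_span extW; have [FR spanR] := ext_dim_span extR.
have [s [sm sz_s reg_sR reg_sW]] := common_regseq mP nR nW
  (fun k => depth_ext_zero (F := FW) depR)
  (fun k => depth_ext_zero (F := FW) depW).
have s0 : zero_dim m s by apply: regseq_zero_dim => //; rewrite sz_s.
(* As [s] has length [d], Ext in degree [d] becomes the socle modulo [s]. *)
have [z [soc_z z_soc]] : exists z : 'I_1 -> W,
    (forall a, socle m (seq_sm W s) (z a)) /\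
    forall v, socle m (seq_sm W s) v ->
      exists c, seq_sm W s (v - \sum_a c a *: z a).
  apply: (@ext_span_socle _ _ FW); apply: ext_span_regseq => //.
    by move=> k; rewrite add0n sz_s; apply: depth_ext_zero depW.
  by rewrite add0n sz_s.
pose t := z ord0.
have t_soc v : socle m (seq_sm W s) v -> exists c, seq_sm W s (v - c *: t).
  by move=> /z_soc [c]; rewrite big_ord1 => cP; exists (c ord0).
have [v1 sv1] : exists v, ~ seq_sm W s v.
  have [L [_ [v Lv] _ mL]] := maximal_submod (N := zero_sm W) mP nW v0_neq0.
  by exists v => /(seq_sm_sub sm mL).
have Nt : ~ seq_sm W s t.
  have [|u [Nu soc_u]] := socle_neq0 mP s0 _ sv1.
    by move=> a u; apply: seq_sm_ideal.
  have [c cP] := t_soc u soc_u => Nt; apply: Nu.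
  by apply/(sm_congr cP); apply: smZ.
have scal := scalar_endos_socle mP s0 (soc_z ord0) t_soc.
have [|scal0 faith] := regseq_scalar_faithful mP nW sm reg_sW _ scal.
  by move=> c c0; apply: ideal_mod_torsion_free (c0 v0) v0_neq0.
have [sigma [soc_sigma sigma_soc]] : exists z : 'I_r -> R^o,
    (forall a, socle m (seq_sm R^o s) (z a)) /\
    forall v, socle m (seq_sm R^o s) v ->
      exists c, seq_sm R^o s (v - \sum_a c a *: z a).
  apply: (@ext_span_socle _ _ FR); apply: ext_span_regseq => //.
    by move=> k; rewrite add0n sz_s; apply: depth_ext_zero depR.
  by rewrite add0n sz_s.
have [gs sz_gs gsP] := generators_le mP nW sm Nt (soc_z ord0) t_soc scal faith
  soc_sigma sigma_soc.
have cyclicP (a : W) : (forall v, exists c, v = c *: a) -> finite_injdim R^o.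
  move=> aP; apply: (cyclic_injdim (a := a)) injW => // a0.
  by have [c] := aP v0; rewrite a0 scaler0.
have [a [b abP]] : exists a b : W, forall v, exists p q, v = p *: a + q *: b.
  exists gs`_0, gs`_1 => v; have /gen_smP [c ->] := gsP v.
  rewrite -sz_gs in r_le2; case: (gs) r_le2 c => [|a [|b [|]]] //= _ c.
  - by exists 0, 0; rewrite big_ord0; module R.
  - by exists (c ord0), 0; rewrite big_ord1 scale0r addr0.
  - exists (c ord0), (c ord_max); rewrite big_ord_recl big_ord1.
    by congr (_ + c _ *: _); apply: val_inj.
apply: contrapT => not_cyclic.
have val_m (u : W) : ideal_val u \in m.
  apply: contrapT => /negP /(local_unit mP) [c cu]; apply: not_cyclic.
  apply: (cyclicP u) => v; exists (ideal_val v * c); apply: ideal_val_inj.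
  by rewrite ideal_valZ -mulrA cu mulr1.
have a_neq0 : ideal_val a != 0.
  apply/eqP => a0; apply: not_cyclic; apply: (cyclicP b) => v.
  have [p [q ->]] := abP v; exists q.
  have -> : a = 0 by apply: ideal_val_inj; rewrite a0 linear0.
  by rewrite scaler0 add0r.
have relations p q : p *: a + q *: b = 0 ->
    exists t, p = - (t * ideal_val b) /\ q = t * ideal_val a.
  move=> pq; have [n [A presA]] := two_gen_presentation abP nR.
  have [_ kerA] := presA.
  have [y yP] := (kerA (\row_j if j == 0 then p else q)).1
    ltac:(by rewrite /= /row2_map !mxE).
  (* The Fitting ideal puts the coefficients of all relations into [w]. *)
  have Aw j : \sum_i y 0 i * A i j \in w.
    apply: rpred_sum => i _; apply: (@rpredZ _ _ w); apply/Fitt_w.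
    exact: Fitt1_entry presA.
  have [p' pE] : exists p' : W, ideal_val p' = p.
    apply: ideal_val_surj; have := Aw 0.
    by have := congr1 (fun u : 'rV_2 => u 0 0) yP; rewrite !mxE /= => <-.
  have [q' qE] : exists q' : W, ideal_val q' = q.
    apply: ideal_val_surj; have := Aw 1.
    by have := congr1 (fun u : 'rV_2 => u 0 1) yP; rewrite !mxE /= => <-.
  rewrite -pE -qE; apply: (relation_scalar abP a_neq0 scal0).
  rewrite pE qE; have := congr1 (@ideal_val _ w) pq.
  by rewrite ideal_valD !ideal_valZ linear0.
have s1 : ~ seq_sm R^o s 1.
  move=> s1; apply: (ideal_sm1 (J := m)).
  by apply: (seq_sm_sub sm _ s1) => c u cm; rewrite /= [_ *: _]mulrC idealMr.
(* Both [a] and [b] kill the socle of [R / (s)]. *)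
have [|c [sc soc_c]] := socle_neq0 mP s0 _ s1.
  by move=> c u sc; apply: seq_sm_ideal.
apply: sc; apply: koszul_exact abP a_neq0 relations _ _ reg_sW _ _.
  by rewrite mulrC; apply/soc_c/val_m.
by rewrite mulrC; apply/soc_c/val_m.
Qed.
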